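(* Let $G$ be an Abelian group admitting a pseudocompact group topology, and fix a decomposition $G=\left(\bigoplus_{p^k\in P_0}\bigoplus_{\gamma(p^k)}\mathbb{Z}(p^k)\right)\oplus H$ where $P_0$ is a finite set of prime powers, each $\gamma(p^k)$ is a cardinal, and $H$ is a subgroup with $|nH|=|H|$ for all $n\in\mathbb{N}$. Let $P_1=\{p^k\in P_0:\gamma(p^k)>r_0(G)\}$ and $G_0=\left(\bigoplus_{p^k\in P_0\setminus P_1}\bigoplus_{\gamma(p^k)}\mathbb{Z}(p^k)\right)\oplus H$, so that $G=\left(\bigoplus_{p^k\in P_1}\bigoplus_{\gamma(p^k)}\mathbb{Z}(p^k)\right)\oplus G_0$. Suppose that each dominant rank $\gamma(p^k)$, $p^k\in P_1$, satisfies property $(\ast)$, and that $r_0(G)$ satisfies property $(\ast)$ for some cardinal $\kappa$ (i.e. $\kappa^\omega\le r_0(G)\le 2^\kappa$) with $m(|G_0|)\leq 2^\kappa$. Then $G$ admits a pseudocompact group topology with property $\mathfrak{h}$.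
   Context: $\mathbb{Z}(p^k)$ is the cyclic group of order $p^k$; $\bigoplus_{\gamma}$ denotes a direct sum of $\gamma$ copies; $r_0(G)$ is the torsion-free rank of $G$. The cardinals $\gamma(p^k)$ with $p^k\in P_1$ are called the dominant ranks of $G$. An infinite cardinal $\alpha$ satisfies property $(\ast)$ if there is a cardinal $\kappa$ with $\kappa^\omega\le\alpha\le 2^\kappa$. For an infinite cardinal $\alpha$, $m(\alpha)$ is the least cardinality of a $G_\delta$-dense subset (a subset meeting every nonempty $G_\delta$-subset) of a compact group of weight $\alpha$; this does not depend on the compact group chosen. A space is pseudocompact if every real continuous function on it is bounded. A subgroup $N$ of a topological Abelian group $K$ is $h$-embedded if every homomorphism $N\to\mathbb{T}$ extends to a continuous homomorphism $K\to\mathbb{T}$; $K$ has property $\mathfrak{h}$ if every countable subgroup of $K$ is $h$-embedded in $K$. *)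

(* Defs.v *)
From HB Require Import structures.
From mathcomp Require Import all_boot all_order all_algebra.
From mathcomp Require Import boolp classical_sets cardinality.
From Stdlib Require Import Rdefinitions Rbasic_fun.

Set Implicit Arguments. Unset Strict Implicit. Unset Printing Implicit Defensive.
Import GRing.Theory.
Local Open Scope classical_set_scope.
Local Open Scope ring_scope.

Definition is_subgroup (G : zmodType) (S : set G) : Prop :=
  S 0 /\ (forall x y, S x -> S y -> S (x - y)).

Definition comb (G : zmodType) (I : eqType) (e : I -> G) (s : seq (I * int)) : G :=
  \sum_(x <- s) (e x.1) *~ x.2.

Definition independent (G : zmodType) (A : set G) : Prop :=
  forall s : seq (G * int), uniq (map fst s) -> (forall x, x \in s -> A x.1) ->
    \sum_(x <- s) x.1 *~ x.2 = 0 -> forall x, x \in s -> x.2 = 0.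

(* A is a maximal independent subset of G; its cardinality is r_0(G) *)
Definition max_independent (G : zmodType) (A : set G) : Prop :=
  independent A /\ forall B : set G, independent B -> A `<=` B -> B = A.

Definition prime_power (q : nat) : Prop := exists p k : nat, prime p /\ (0 < k)%nat /\ q = expn p k.

(* G = (\oplus_{i in I} <e i>) \oplus H, with <e i> cyclic of order ord i \in P0.
   The cardinal gamma(q) is the cardinality of [set i | ord i = q]. *)
Definition decomposition (G : zmodType) (P0 : seq nat) (I : eqType)
    (ord : I -> nat) (e : I -> G) (H : set G) : Prop :=
  [/\ (forall q, q \in P0 -> prime_power q) /\
      (forall i, ord i \in P0),
      forall i, e i *+ ord i = 0,
      is_subgroup H,
      (forall g : G, exists s h, H h /\ g = comb e s + h) &
      (forall s h, uniq (map fst s) -> H h -> comb e s + h = 0 ->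
          h = 0 /\ forall x, x \in s -> x.2 \in dvdz (Posz (ord x.1)))].

Definition partial_sum (G : zmodType) (I : eqType) (ord : I -> nat) (e : I -> G)
    (H : set G) (P : nat -> Prop) : set G :=
  [set g | exists s h, H h /\ (forall x, x \in s -> P (ord x.1)) /\ g = comb e s + h].

(* property (\ast) for a (cardinal represented by a) set A, with witness K *)
Definition star_with (T : Type) (A : set T) (K : Type) : Prop :=
  infinite_set A /\ ([set: nat -> K] #<= A)%card /\ (A #<= [set: K -> bool])%card.

Definition star (T : Type) (A : set T) : Prop := exists K : Type, star_with A K.

Definition cube_open (X : Type) (U : set (X -> bool)) : Prop :=
  forall f, U f -> exists F : seq X,
    (forall g : X -> bool, (forall x, List.In x F -> g x = f x) -> U g) .

Definition cube_Gdelta (X : Type) (S : set (X -> bool)) : Prop :=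
  exists U : nat -> set (X -> bool), (forall n, cube_open (U n)) /\ S = \bigcap_n U n.

Definition Gdelta_dense (X : Type) (D : set (X -> bool)) : Prop :=
  forall S, cube_Gdelta S -> S !=set0 -> (D `&` S) !=set0.

(* m(|X|) <= |B| : the compact group {0,1}^X (of weight |X| for infinite X)
   has a G_delta-dense subset of cardinality at most |B| *)
Definition m_le (X : Type) (T : Type) (B : set T) : Prop :=
  exists D : set (X -> bool), Gdelta_dense D /\ (D #<= B)%card.

Definition group_topology (G : zmodType) (tau : set (set G)) : Prop :=
  [/\ tau setT /\ tau set0,
      (forall F : set (set G), F `<=` tau -> tau (\bigcup_(U in F) U)),
      (forall U V, tau U -> tau V -> tau (U `&` V)),
      (forall x y U, tau U -> U (x - y) -> exists V W, [/\ tau V, tau W, V x, W y &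
          forall a b, V a -> W b -> U (a - b)]) &
      (forall x y, x <> y -> exists U V, [/\ tau U, tau V, U x, V y & U `&` V = set0])].

Definition continuous_real (G : zmodType) (tau : set (set G)) (f : G -> R) : Prop :=
  forall x (eps : R), Rlt 0 eps -> exists U, [/\ tau U, U x &
     forall y, U y -> Rlt (Rabs (Rminus (f y) (f x))) eps].

Definition pseudocompact (G : zmodType) (tau : set (set G)) : Prop :=
  forall f : G -> R, continuous_real tau f -> exists M : R, forall x, Rle (Rabs (f x)) M.

(* maps into T = R/Z, represented by real-valued representatives *)
Definition is_int (r : R) : Prop := exists z : BinNums.Z, r = IZR z.

Definition hom_T_on (G : zmodType) (N : set G) (f : G -> R) : Prop :=
  forall x y, N x -> N y -> is_int (Rminus (Rminus (f (x + y)) (f x)) (f y)).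

Definition continuous_T (G : zmodType) (tau : set (set G)) (f : G -> R) : Prop :=
  forall x (eps : R), Rlt 0 eps -> exists U, [/\ tau U, U x &
     forall y, U y -> exists z : BinNums.Z, Rlt (Rabs (Rminus (Rminus (f y) (f x)) (IZR z))) eps].

Definition h_embedded (G : zmodType) (tau : set (set G)) (N : set G) : Prop :=
  forall f : G -> R, hom_T_on N f ->
    exists g : G -> R, [/\ hom_T_on setT g, continuous_T tau g &
       forall x, N x -> is_int (Rminus (g x) (f x))].

Definition property_h (G : zmodType) (tau : set (set G)) : Prop :=
  forall N : set G, is_subgroup N -> countable N -> h_embedded tau N.

Definition admits_pseudocompact (G : zmodType) : Prop :=
  exists tau : set (set G), group_topology tau /\ pseudocompact tau.

(* Main.v *)
(** Let T = R/Z. A family of characters of G induces a pseudocompact group topology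
    as soon as it maps G onto all countable subproducts of T (or of the torsion groups
    T[q]): a sequence along which a continuous function is unbounded has an ultralimit
    on the countably many relevant coordinates, and this ultralimit is attained in G.
    Property h holds as soon as the family also realises every character of every
    countable subgroup. So one needs a matrix, with rows the elements of G and columns
    the characters, in which all countable patterns occur both along rows and along
    columns.

    On a dominant summand, a direct sum of gamma copies of Z(q) with
    kappa^omega <= gamma <= 2^kappa, columns indexed by kappa^omega realise all patterns
    on countable sets of rows, each uncountably often. There are only
    kappa^omega <= gamma countable patterns on columns, so each can be written by force
    into a row of its own; a countable set of rows then spoils countably many columns.

    On G_0, the bound m(|G_0|) <= 2^kappa yields 2^kappa characters which separate points,
    and then 2^kappa characters y realising all characters of countable subgroups. Fix a
    free family (b_w), w in kappa^omega, inside a maximal one. For a countable set S of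
    indices, change y at the b_w with w outside S so as to realise all countable patterns
    on the set of pairs (y, S); a countable subgroup only meets countably many b_w, hence
    the characters of countable subgroups are still realised. *)
Require Import Defs.
From HB Require Import structures.
From Stdlib Require Import Rdefinitions Rbasic_fun.
From Stdlib Require Import RIneq Lra R_Ifp.
From mathcomp Require Import all_boot all_order all_algebra.
From mathcomp Require Import boolp classical_sets cardinality.
From mathcomp Require Import functions filter ring_quotient reals Rstruct.
Local Open Scope classical_set_scope.
Local Open Scope ring_scope.
Import Order.TTheory GRing.Theory Num.Theory.
Set Implicit Arguments. Unset Strict Implicit. Unset Printing Implicit Defensive.

(** * Partial homomorphisms *)

Lemma Zorn_above (T : Type) (P : set (set T)) (A0 : set T) :
  P A0 ->
  (forall F : set (set T), F !=set0 -> F `<=` P -> total_on F subset ->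
    P (\bigcup_(X in F) X)) ->
  exists A, [/\ A0 `<=` A, P A & forall B, A `<=` B -> P B -> B `<=` A].
Proof.
(* The empty chain has union [set0], which need not satisfy [P]; [Q] admits it by fiat, and other
   unions are then taken over the nonempty members only. *)
move=> P0 Pchain; pose Q X := X = set0 \/ (A0 `<=` X /\ P X).
have [F FQ totF|A [QA Amax]] := @Zorn_bigcup T Q.
  have [[X [FX X0]]|F0] := pselect (exists X, F X /\ X <> set0); last first.
    left; rewrite -subset0 => x [X FX Xx]; apply: F0; exists X; split=> // X0.
    by rewrite X0 in Xx.
  have [//|[A0X PX]] := FQ _ FX.
  right; split; first by move=> x /A0X Xx; exists X.
  pose F' := F `&` [set Y | Y !=set0].
  have -> : \bigcup_(Y in F) Y = \bigcup_(Y in F') Y.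
    apply/seteqP; split=> x [Y FY Yx]; first by exists Y => //; split=> //; exists x.
    by exists Y => //; case: FY.
  apply: Pchain.
  - exists X; split => //; apply: contrapT => Xn; apply: X0; rewrite -subset0 => x Xx; by case: Xn; exists x.
  - move=> Y [FY [y Yy]]; case: (FQ _ FY) => [Y0|[]//].
    by rewrite Y0 in Yy.
  - by move=> Y Z [FY _] [FZ _]; exact: totF.
case: QA => [A_0|[A0A PA]].
  have A00 : A0 = set0.
    have QA0 : Q A0 by right; split.
    apply: contrapT => A0n; apply: (Amax A0 _ QA0).
    by rewrite A_0; split=> // s; apply: A0n; rewrite -subset0.
  exists A; rewrite A_0; split; [by rewrite A00 | by rewrite -A00 | move=> B _ PB x Bx].
  have BA : ~ (A `<` B) by move=> /Amax; apply; right; rewrite A00; split.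
  by apply: contrapT => _; apply: BA; rewrite A_0; split=> // /(_ x Bx).
exists A; split=> // B AB PB x Bx; apply: contrapT => nAx.
have QB : Q B by right; split=> //; apply: subset_trans AB.
by apply: (Amax B _ QB); split=> // /(_ x Bx).
Qed.

Section Subgroups.
Variables (G : zmodType) (S : set G).
Hypothesis subS : is_subgroup S.

Lemma subgroupB x y : S x -> S y -> S (x - y).
Proof. by case: subS => _; apply. Qed.

Lemma subgroupN x : S x -> S (- x).
Proof. by case: subS => S0 SB Sx; rewrite -sub0r; apply: SB. Qed.

Lemma subgroupD x y : S x -> S y -> S (x + y).
Proof. by move=> Sx Sy; rewrite -[y]opprK; apply: subgroupB => //; apply: subgroupN. Qed.

Lemma subgroupMz x (n : int) : S x -> S (x *~ n).
Proof.
move=> Sx; have SMn m : S (x *+ m).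
  by elim: m => [|m IH]; [case: subS | rewrite mulrS; apply: subgroupD].
by case: n => m; [exact: SMn | rewrite NegzE mulrNz; apply: subgroupN; exact: SMn].
Qed.

Lemma subgroup_sum (J : eqType) (s : seq J) (F : J -> G) :
  (forall x, x \in s -> S (F x)) -> S (\sum_(x <- s) F x).
Proof.
move=> SF; rewrite big_seq; elim/big_ind: _ => //; last exact: subgroupD.
by case: subS.
Qed.

End Subgroups.

Lemma additive_subgroup_image (G M : zmodType) (f : {additive G -> M}) (S : set G) :
  is_subgroup S -> is_subgroup [set f x | x in S].
Proof.
move=> [S0 SB]; split; first by exists 0; rewrite ?raddf0.
by move=> _ _ [x Sx <-] [y Sy <-]; exists (x - y); [exact: SB | rewrite raddfB].
Qed.

(** For a subgroup of the product, being single-valued at 0 already makes it the graph of a partial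
    homomorphism. *)
Definition functional (G M : zmodType) (F : set (G * M)) : Prop :=
  forall m, F (0, m) -> m = 0.

Lemma functional_eq (G M : zmodType) (F : set (G * M)) x m m' :
  is_subgroup F -> functional F -> F (x, m) -> F (x, m') -> m = m'.
Proof.
move=> subF funF Fm Fm'; apply/eqP; rewrite -subr_eq0; apply/eqP; apply: funF.
by have := subgroupB subF Fm Fm'; rewrite /= -[X in F X]/(x - x, m - m') subrr.
Qed.

Lemma additive_of_graph (G M : zmodType) (F : set (G * M)) :
  is_subgroup F -> functional F -> (forall g, exists m, F (g, m)) ->
  exists f : {additive G -> M}, forall g m, F (g, m) -> f g = m.
Proof.
move=> subF funF totF; have [f Ff] := choice totF.
have fB : zmod_morphism f.
  move=> x y; apply: (functional_eq subF funF (Ff _)).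
  exact: (subgroupB subF (Ff x) (Ff y)).
pose fa : {additive G -> M} := HB.pack f (GRing.isZmodMorphism.Build G M f fB).
exists fa => g m; exact: (functional_eq subF funF).
Qed.

Lemma pairMz (G M : zmodType) (x : G) (y : M) (k : int) :
  (x, y) *~ k = (x *~ k, y *~ k).
Proof.
by rewrite [LHS]surjective_pairing (raddfMz fst) (raddfMz snd).
Qed.

Definition divisible (T : zmodType) : Prop :=
  forall (n : nat) (t : T), (0 < n)%nat -> exists u, u *+ n = t.

(* The least positive n with n g in the domain of F forces the value at g up to
   n-torsion: divisibility supplies one, and any value will do if there is no such n. *)
Lemma adjoin_value (G T : zmodType) (F : set (G * T)) (g : G) :
  divisible T -> is_subgroup F -> functional F ->
  exists t, forall (k : int) m, F (g *~ k, m) -> m = t *~ k.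
Proof.
move=> divT subF funF.
pose Q n := `[< (0 < n)%nat /\ exists m, F (g *+ n, m) >].
have [[n0 Qn0]|nQ] := pselect (exists n, Q n); last first.
  have kill k m : F (g *~ k, m) -> k = 0.
    move=> Fk; apply: contrapT => k0; apply: nQ.
    exists (absz k); apply/asboolP; split; first by rewrite absz_gt0; apply/eqP.
    case: k k0 Fk => j k0 Fk; first by exists m.
    exists (- m); have := subgroupN subF Fk; rewrite NegzE mulrNz.
    by rewrite -[X in F X]/(- - (g *~ j.+1), - m) opprK.
  by exists 0 => k m Fk; move: (kill _ _ Fk) (Fk) => ->; rewrite mulr0z => /funF ->.
case: (ex_minnP (ex_intro _ n0 Qn0)) => n /asboolP[n_gt0 [v Fv]] nmin.
have [t tn] := divT n v n_gt0; exists t => k m Fk.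
have Fr : F (g *~ (k %% n)%Z, m - v *~ (k %/ n)%Z).
  have := subgroupB subF Fk (subgroupMz subF (k %/ n)%Z Fv); rewrite pairMz.
  rewrite -[X in F X -> _]/(_ - _, _ - _) pmulrn -mulrzA -mulrzBr.
  by rewrite {1}(divz_eq k n) mulrC addrAC subrr add0r.
have r0 : (k %% n)%Z = 0.
  have := modz_ge0 k (_ : n%:Z != 0); have := ltz_mod k (_ : n%:Z != 0).
  have nz : n%:Z != 0 by rewrite -lt0n.
  move=> /(_ nz) + /(_ nz).
  case: (k %% n)%Z Fr => // r Fr; rewrite ltz_nat => rn _.
  apply/eqP; rewrite eqz_nat -leqn0 leqNgt; apply/negP => r_gt0.
  have : (n <= r)%nat by apply: nmin; apply/asboolP; split=> //; eexists; exact: Fr.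
  by rewrite leqNgt rn.
move: Fr; rewrite r0 mulr0z => /funF /eqP; rewrite subr_eq0 => /eqP ->.
rewrite -tn {2}(divz_eq k n) r0 addr0 mulrC mulrzA.
by rewrite pmulrn.
Qed.

(** Divisible groups are injective: among the partial homomorphisms extending [F0] a maximal one is
    total, since [adjoin_value] would otherwise enlarge its domain. *)
Lemma graph_extension (G T : zmodType) (F0 : set (G * T)) :
  divisible T -> is_subgroup F0 -> functional F0 ->
  exists f : {additive G -> T}, forall g m, F0 (g, m) -> f g = m.
Proof.
move=> divT subF0 funF0.
pose P (F : set (G * T)) := is_subgroup F /\ functional F.
have [||F [F0F [subF funF] Fmax]] := @Zorn_above _ P F0.
- by split.
- move=> C [X0 CX0] CP totC; split; first split.
  + by exists X0 => //; have [[]] := CP _ CX0.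
  + move=> x y [X CX Xx] [Y CY Yy].
    have [XY|YX] := totC _ _ CX CY.
      by exists Y => //; apply: subgroupB => //; [case: (CP _ CY) | exact: XY].
    by exists X => //; apply: subgroupB => //; [case: (CP _ CX) | exact: YX].
  + by move=> m [X /CP[_ funX]]; exact: funX.
have totF g : exists m, F (g, m).
  have [t tP] := adjoin_value g divT subF funF.
  pose F' : set (G * T) := [set z | exists y k, F y /\ z = (y.1 + g *~ k, y.2 + t *~ k)].
  suff F'F : F' `<=` F.
    exists t; apply: F'F; exists 0, 1; split; first by case: subF.
    by rewrite /= !add0r.
  apply: Fmax.
    by move=> [a b] Fab; exists (a, b), 0; split=> //; rewrite /= !mulr0z !addr0.
  split; first split.
  - by exists 0, 0; split; [case: subF | rewrite /= !mulr0z !addr0].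
  - move=> _ _ [y [k [Fy ->]]] [y' [k' [Fy' ->]]].
    exists (y - y'), (k - k'); split; first exact: subgroupB.
    rewrite /= !mulrzBr -[LHS]/(_ - _, _ - _); congr (_, _).
      by rewrite opprD addrACA.
    by rewrite opprD addrACA.
  - move=> m [[a b] [k [Fy /= [a0 ->]]]].
    have ak : a = g *~ (- k) by rewrite mulrNz; apply/eqP; rewrite -addr_eq0 -a0.
    by move: Fy; rewrite ak => /tP ->; rewrite mulrNz addNr.
have [f fP] := additive_of_graph subF funF totF.
by exists f => g m /F0F; exact: fP.
Qed.

(** * Integral combinations of families *)

Section Combinations.
Variables (J : eqType).
Implicit Types (s : seq (J * int)).

(** Independence is stated for lists without repeated indices; merging the coefficients of equal
    indices reduces arbitrary lists to these. *)
Definition collect s : seq (J * int) :=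
  [seq (i, \sum_(x <- s | x.1 == i) x.2) | i <- undup (map fst s)].

Lemma collect_fst s : map fst (collect s) = undup (map fst s).
Proof. by rewrite /collect -map_comp map_id. Qed.

Lemma collect_uniq s : uniq (map fst (collect s)).
Proof. by rewrite collect_fst undup_uniq. Qed.

Lemma mem_collect s x : x \in collect s -> x.1 \in map fst s.
Proof. by move=> /(map_f fst); rewrite collect_fst mem_undup. Qed.

Lemma comb_collect (G : zmodType) (b : J -> G) s : comb b (collect s) = comb b s.
Proof.
rewrite /comb big_map /=.
under eq_bigr => i _ do rewrite mulrz_sumr.
rewrite (exchange_big_dep xpredT) //= big_seq [RHS]big_seq.
apply: eq_bigr => x xs.
rewrite big_mkcond (bigD1_seq x.1) ?undup_uniq ?mem_undup ?map_f //= eqxx.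
by rewrite big1 ?addr0 // => i /negPf ix; rewrite eq_sym ix.
Qed.

Lemma comb_cat (G : zmodType) (b : J -> G) s s' : comb b (s ++ s') = comb b s + comb b s'.
Proof. by rewrite /comb big_cat. Qed.

Definition oppc s : seq (J * int) := [seq (x.1, - x.2) | x <- s].

Lemma comb_opp (G : zmodType) (b : J -> G) s : comb b (oppc s) = - comb b s.
Proof. by rewrite /comb big_map -sumrN; apply: eq_bigr => x _; rewrite mulrNz. Qed.

Lemma oppc_fst s : map fst (oppc s) = map fst s.
Proof. by rewrite -map_comp. Qed.

Lemma comb_additive (G M : zmodType) (f : {additive G -> M}) (b : J -> G) s :
  f (comb b s) = comb (f \o b) s.
Proof. by rewrite /comb raddf_sum; apply: eq_bigr => x _; rewrite raddfMz. Qed.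

Definition scalec (k : nat) s : seq (J * int) := [seq (x.1, x.2 *+ k) | x <- s].

Lemma comb_scale (G : zmodType) (b : J -> G) k s : comb b (scalec k s) = comb b s *+ k.
Proof. by rewrite /comb big_map -sumrMnl; apply: eq_bigr => x _; rewrite [x.2 *+ k]pmulrn mulrzz mulrzA -pmulrn. Qed.

Lemma eq_comb (G : zmodType) (b b' : J -> G) s :
  (forall x, x \in s -> b x.1 = b' x.1) -> comb b s = comb b' s.
Proof. by move=> bb'; apply: eq_big_seq => x /bb' ->. Qed.

End Combinations.

(** * Cardinal arithmetic through explicit injections *)

Definition emb (A B : Type) : Prop := exists f : A -> B, injective f.

Lemma emb_refl A : emb A A.
Proof. by exists id. Qed.

Lemma emb_trans A B C : emb A B -> emb B C -> emb A C.
Proof. by move=> [f fI] [g gI]; exists (g \o f); exact: inj_comp. Qed.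

Lemma emb_prod A A' B B' : emb A A' -> emb B B' -> emb (A * B) (A' * B').
Proof.
move=> [f fI] [g gI]; exists (fun x => (f x.1, g x.2)).
by move=> [a b] [c d] [/fI /= -> /gI /= ->].
Qed.

Lemma emb_fun A B C : emb A B -> emb (C -> A) (C -> B).
Proof.
move=> [f fI]; exists (fun h => f \o h) => h k hk.
by apply/funext => x; apply: fI; exact: (congr1 (fun u => u x) hk).
Qed.

Lemma emb_pow A B : emb A B -> emb (A -> bool) (B -> bool).
Proof.
move=> [f fI]; exists (fun h b => `[< exists2 a, f a = b & h a >]) => h k hk.
apply/funext => x; have := congr1 (fun u => u (f x)) hk => /= {}hk.
apply/idP/idP => [hx|kx].
  have : `[< exists2 a, f a = f x & h a >] by apply/asboolP; exists x.
  by rewrite hk => /asboolP[a /fI ->].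
have : `[< exists2 a, f a = f x & k a >] by apply/asboolP; exists x.
by rewrite -hk => /asboolP[a /fI ->].
Qed.

Lemma emb_left_inverse A B (a0 : A) (f : A -> B) :
  injective f -> exists g : B -> A, cancel f g.
Proof.
move=> fI; have /choice[g gP] : forall b, exists a, forall a', f a' = b -> a = a'.
  move=> b; have [[a <-]|nb] := pselect (exists a, f a = b).
    by exists a => a' /fI.
  by exists a0 => a' fa'; case: nb; exists a'.
by exists g => a; exact: gP.
Qed.

Definition unpair (k : nat) : nat * nat := odflt (0%N, 0%N) (unpickle k).

Lemma unpairK (p : nat * nat) : unpair (pickle p) = p.
Proof. by rewrite /unpair pickleK. Qed.

Lemma emb_seqseq A : emb (nat -> nat -> A) (nat -> A).
Proof.
exists (fun h k => h (unpair k).1 (unpair k).2) => h h' hh'.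
apply/funext => m; apply/funext => n.
by have := congr1 (fun u => u (pickle (m, n))) hh'; rewrite /= unpairK.
Qed.

(** The cardinals with $Q^\omega=Q$; the second clause excludes 0 and 1, so that [Q] has at least
    $2^\omega$ elements. *)
Definition absorbing (Q : Type) : Prop := emb (nat -> Q) Q /\ emb bool Q.

Section Absorbing.
Variable Q : Type.
Hypothesis absQ : absorbing Q.

Lemma absorbing_inhabited : exists q : Q, True.
Proof. by case: absQ => _ [f _]; exists (f true). Qed.

Lemma absorbing_sequences A : emb A Q -> emb (nat -> A) Q.
Proof. by move=> /(@emb_fun _ _ nat) /emb_trans; apply; case: absQ. Qed.

Lemma absorbing_bool : emb bool Q. Proof. by case: absQ. Qed.

Lemma absorbing_nat : emb nat Q.
Proof.
apply: emb_trans (absorbing_sequences absorbing_bool).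
exists (fun n m => n == m) => m n mn.
by have := congr1 (fun u => u m) mn; rewrite eqxx => /esym/eqP.
Qed.

Lemma absorbing_prod A B : emb A Q -> emb B Q -> emb (A * B) Q.
Proof.
move=> AQ BQ; apply: emb_trans (emb_prod AQ BQ) _.
apply: emb_trans (absorbing_sequences (emb_refl Q)).
exists (fun x n => if n is 0 then x.1 else x.2) => -[a b] [c d] h.
by have := congr1 (fun u => u 0%N) h; have := congr1 (fun u => u 1%N) h => /= -> ->.
Qed.

Lemma absorbing_list A : emb A Q -> emb (seq A) Q.
Proof.
have [q0 _] := absorbing_inhabited => -[f fI].
apply: emb_trans (absorbing_sequences (absorbing_prod absorbing_bool (emb_refl Q))).
exists (fun (s : seq A) n => ((n < size s)%N, nth q0 (map f s) n)) => s s' h.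
have hn n := congr1 (fun u => u n) h.
have ss' : size s = size s'.
  apply/eqP; rewrite eqn_leq; apply/andP; split.
    by rewrite leqNgt; have [-> _] := hn (size s'); rewrite ltnn.
  by rewrite leqNgt; have [<- _] := hn (size s); rewrite ltnn.
apply: (inj_map fI); apply: (@eq_from_nth _ q0); first by rewrite !size_map.
by move=> i _; have [_] := hn i.
Qed.

Lemma absorbing_pow : absorbing (Q -> bool).
Proof.
split; last first.
  have [q0 _] := absorbing_inhabited.
  by exists (fun b _ => b) => b c h; exact: (congr1 (fun u => u q0) h).
apply: emb_trans (emb_pow (absorbing_prod absorbing_nat (emb_refl Q))).
exists (fun h x => h x.1 x.2) => h k hk; apply/funext => n; apply/funext => x.
exact: (congr1 (fun u => u (n, x)) hk).
Qed.

Lemma emb_singletons A : emb A (A -> bool).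
Proof.
exists (fun x y => `[< x = y >]) => x y h.
have := congr1 (fun u => u y) h => /= h'.
by apply/asboolP; rewrite h'; apply/asboolP.
Qed.

End Absorbing.

Lemma absorbing_omega_pow K : emb bool K -> absorbing (nat -> K).
Proof.
move=> bK; split; first exact: emb_seqseq.
apply: emb_trans bK _; exists (fun x _ => x) => x y h.
exact: (congr1 (fun u => u 0%N) h).
Qed.

(* The Hewitt-Marczewski-Pondiczery construction for the G_delta topology: a
   countable part of [I] is separated by a sequence [s] of coordinates of [Q], so
   a function on it is coded by [s], the traces on [s], and a list of values. The
   last component of the code makes the realisations uncountably many. *)
Lemma pattern_matrix (Q I V : Type) (v0 : V) :
  absorbing Q -> emb I (Q -> bool) -> emb V Q ->
  exists M : I -> Q -> V, forall (c : nat -> I) (t : I -> V) (z : nat -> Q),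
    exists w, (forall n, w <> z n) /\ forall n, M (c n) w = t (c n).
Proof.
move=> absQ [a aI] VQ.
pose W := ((nat -> Q) * (nat -> nat -> bool) * (nat -> V) * (nat -> bool))%type.
have [q0 _] := absorbing_inhabited absQ.
have [h hI] : emb W Q.
  have bQ := absorbing_bool absQ; have sQ := absorbing_sequences absQ.
  apply: absorbing_prod (sQ _ bQ) => //; apply: absorbing_prod (sQ _ VQ) => //.
  by apply: absorbing_prod (sQ _ (sQ _ bQ)) => //; exact/sQ/emb_refl.
have [g hK] := emb_left_inverse (fun=> q0, fun _ _ => true, fun=> v0, fun=> true) hI.
pose hit (x : I * W) n := forall k, a x.1 (x.2.1.1.1 k) = x.2.1.1.2 n k.
have /choice[M0 M0P] : forall x, exists y, (exists n, hit x n) ->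
    exists n, hit x n /\ y = x.2.1.2 n.
  move=> x; have [[n xn]|nx] := pselect (exists n, hit x n).
    by exists (x.2.1.2 n) => _; exists n.
  by exists v0.
exists (fun i q => M0 (i, g q)) => c t z.
(* Position [pickle (m, n)] of [s] holds a coordinate telling [c m] from [c n], so countably many
   coordinates separate the whole sequence. *)
have /choice[s sP] : forall k, exists q,
    c (unpair k).1 <> c (unpair k).2 -> a (c (unpair k).1) q <> a (c (unpair k).2) q.
  move=> k; apply: contrapT => nq.
  have [cc|cc] := pselect (c (unpair k).1 = c (unpair k).2).
    by apply: nq; exists q0.
  apply: cc; apply: aI; apply/funext => q; apply: contrapT => ne.
  by apply: nq; exists q.
pose w : W := (s, fun n k => a (c n) (s k), t \o c, fun n => ~~ (g (z n)).2 n).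
exists (h w); split=> n.
  by move=> wz; have := hK w; rewrite wz => /(congr1 (fun u => u.2 n)) /=; case: (_ n).
rewrite hK; have [|m [hm ->]] := M0P (c n, w); first by exists n.
rewrite /w /=; congr t; apply: contrapT => nm.
have := sP (pickle (m, n)); rewrite unpairK /= => /(_ nm); apply.
by rewrite [RHS]hm.
Qed.

(* Overwrite the row coding the pair (c, v) along c by v; a countable set of rows
   loses only countably many columns. *)
Lemma two_sided_matrix (Q I V : Type) (v0 : V) :
  absorbing Q -> emb I (Q -> bool) -> emb Q I -> emb V Q ->
  exists M : I -> Q -> V,
    (forall (c : nat -> I) (t : I -> V), exists x, forall n, M (c n) x = t (c n)) /\
    (forall (c : nat -> Q) (t : Q -> V), exists i, forall n, M i (c n) = t (c n)).
Proof.
move=> absQ IQ QI VQ; have [M1 M1P] := pattern_matrix v0 absQ IQ VQ.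
have [i0 iI] : emb ((nat -> Q) * (nat -> V)) I.
  apply: emb_trans QI; apply: absorbing_prod => //.
    exact/(absorbing_sequences absQ)/emb_refl.
  exact: absorbing_sequences.
have [q0 _] := absorbing_inhabited absQ.
pose row (x : I * Q) (p : (nat -> Q) * (nat -> V)) n := x.1 = i0 p /\ x.2 = p.1 n.
(* If [p.1] repeats a column, the entry follows one of the repetitions; this is harmless when the
   values come from a function of the column. *)
have /choice[M MP] : forall x, exists y,
    (forall p n, row x p n -> exists m, row x p m /\ y = p.2 m) /\
    ((forall p n, ~ row x p n) -> y = M1 x.1 x.2).
  move=> x; have [[p [n xpn]]|nx] := pselect (exists p n, row x p n).
    exists (p.2 n); split=> [p' m [xp' _]|/(_ p n)//].
    have /iI <- : i0 p = i0 p' by rewrite -xp'; case: xpn.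
    by exists n.
  exists (M1 x.1 x.2); split=> // p n xpn; case: nx; by exists p, n.
exists (fun i q => M (i, q)); split=> c t; last first.
  exists (i0 (c, t \o c)) => n.
  have [+ _] := MP (i0 (c, t \o c), c n).
  by move=> /(_ (c, t \o c) n (conj erefl erefl))[m [[_ /= cm] ->]]; rewrite /= cm.
(* [z n] lists the columns overwritten in row [c n], if that row codes a pair; [w] is then chosen
   off all these lists, where the matrix is still [M1]. *)
have /choice[z zP] : forall n, exists z : nat -> Q, forall p, c n = i0 p -> z = p.1.
  move=> n; have [[p cp]|nc] := pselect (exists p, c n = i0 p).
    by exists p.1 => p'; rewrite cp => /iI ->.
  by exists (fun=> q0) => p cp; case: nc; exists p.
have [w [wz wP]] := M1P c t (fun k => z (unpair k).1 (unpair k).2).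
exists w => n; rewrite -wP; have [_] := MP (c n, w); apply=> p m [/= cp wp].
by apply: (wz (pickle (n, m))); rewrite unpairK /= (zP n p cp).
Qed.

Lemma emb_card_le (T U : Type) (A : set T) (B : set U) :
  (A #<= B)%card -> emb {x | A x} {y | B y}.
Proof.
move=> /card_leP[f].
exists (fun x => exist _ (sval (f (exist _ (sval x) (mem_set (svalP x)))))
                   (set_mem (svalP (f (exist _ (sval x) (mem_set (svalP x))))))).
move=> [x Ax] [y Ay] /(congr1 sval) /= h.
have /inj := val_inj h; rewrite !inE => /(_ Logic.I Logic.I) /(congr1 sval) /= xy.
exact: eq_exist.
Qed.

Lemma emb_setT (T : Type) : emb {x : T | [set: T] x} T.
Proof. by exists sval => -[x []] [y []] /= ->. Qed.

Lemma emb_to_setT (T : Type) : emb T {x : T | [set: T] x}.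
Proof. by exists (fun x => exist _ x Logic.I) => x y []. Qed.

(** With $\kappa$ replaced by $\kappa^\omega$ the bounds persist, as $2^\kappa\le
    2^{\kappa^\omega}$, and the new cardinal is closed under countable powers. *)
Lemma star_with_absorbing (T : Type) (A : set T) (K : Type) : star_with A K ->
  [/\ absorbing (nat -> K), emb (nat -> K) {x | A x} &
      emb {x | A x} ((nat -> K) -> bool)].
Proof.
move=> [Ainf [KA AK]].
have AK' := emb_trans (emb_card_le AK) (@emb_setT _).
have KA' := emb_trans (@emb_to_setT _) (emb_card_le KA).
split=> //; last first.
  apply: emb_trans AK' (emb_pow _); exists (fun x _ => x) => x y h.
  exact: (congr1 (fun u => u 0%N) h).
apply: absorbing_omega_pow.
(* A type [K] with at most one element has at most two Boolean functions, too few for an infinite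
   [A]. *)
have [[x [y xy]]|K1] := pselect (exists x y : K, x <> y).
  by exists (fun b : bool => if b then x else y) => -[] [] // /esym.
have eqK (x y : K) : x = y by apply: contrapT => xy; apply: K1; exists x, y.
have /infiniteP/emb_card_le nA := Ainf.
have [f fI] := emb_trans (@emb_to_setT nat) (emb_trans nA AK').
have [[k]|nK] := pselect (exists k : K, True); last first.
  have : f 0%N = f 1%N by apply/funext => k; case: nK; exists k.
  by move=> /fI.
have fE m n : f m k = f n k -> m = n.
  by move=> mn; apply: fI; apply/funext => j; rewrite (eqK j k).
case E0 : (f 0%N k); case E1 : (f 1%N k); case E2 : (f 2%N k);
  by [have := fE 0%N 1%N; rewrite E0 E1 => /(_ erefl)
     |have := fE 0%N 2%N; rewrite E0 E2 => /(_ erefl)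
     |have := fE 1%N 2%N; rewrite E1 E2 => /(_ erefl)].
Qed.

(** * Characters *)

(** The hypothesis on relations says exactly that the subgroup generated by the graph of [f0] on [N]
    and the pairs [(b j, v j)], [j] in [P], is functional. *)
Lemma family_extension (G T : zmodType) (J : eqType) (N : set G)
    (f0 : {additive G -> T}) (P : set J) (b : J -> G) (v : J -> T) :
  divisible T -> is_subgroup N ->
  (forall g s, N g -> (forall x, x \in s -> P x.1) ->
    g + comb b s = 0 -> f0 g + comb v s = 0) ->
  exists f : {additive G -> T},
    (forall g, N g -> f g = f0 g) /\ (forall j, P j -> f (b j) = v j).
Proof.
move=> divT subN cons.
pose F : set (G * T) := [set z | exists g s, [/\ N g, forall x, x \in s -> P x.1 &
  z = (g + comb b s, f0 g + comb v s)]].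
have subF : is_subgroup F.
  split; first by exists 0, [::]; split=> //; [case: subN | rewrite /comb !big_nil raddf0 !addr0].
  move=> _ _ [g [s [Ng Ps ->]]] [g' [s' [Ng' Ps' ->]]].
  exists (g - g'), (s ++ oppc s'); split; first exact: subgroupB.
    move=> x; rewrite mem_cat => /orP[/Ps//|xs].
    have : x.1 \in map fst (oppc s') by apply: map_f.
    by rewrite oppc_fst => /mapP[y /Ps' Py ->].
  rewrite !comb_cat !comb_opp raddfB -[LHS]/(_ - _, _ - _).
  by congr (_, _); rewrite opprD addrACA.
have funF : functional F by move=> m [g [s [Ng Ps [/esym e0 ->]]]]; exact: cons.
have [f fP] := graph_extension divT subF funF.
exists f; split=> [g Ng|j Pj]; apply: fP.
  by exists g, [::]; split; rewrite // /comb !big_nil !addr0.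
exists 0, [:: (j, 1)]; split; first by case: subN.
  by move=> x; rewrite inE => /eqP ->.
by rewrite /comb !big_seq1 raddf0 !add0r.
Qed.

Lemma trivial_subgroup (G : zmodType) : is_subgroup [set (0 : G)].
Proof. by split=> // x y -> ->; rewrite subr0. Qed.

(** The cyclic groups generated by the members of [S] form a direct sum. Elements of finite order
    are allowed, in contrast with [independent]. *)
Definition direct_family (G : zmodType) (S : set G) : Prop :=
  forall s : seq (G * int), uniq (map fst s) -> (forall x, x \in s -> S x.1) ->
    comb id s = 0 -> forall x, x \in s -> x.1 *~ x.2 = 0.

Lemma chain_finite_subset (T : Type) (U : eqType) (h : U -> T)
    (C : set (set T)) (s : seq U) :
  C !=set0 -> total_on C subset ->
  (forall x, x \in s -> (\bigcup_(X in C) X) (h x)) ->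
  exists2 X, C X & forall x, x \in s -> X (h x).
Proof.
move=> [X0 CX0] totC; elim: s => [|a s IH] sC; first by exists X0.
have [|X CX sX] := IH; first by move=> x xs; apply: sC; rewrite inE xs orbT.
have [|Y CY aY] := sC a; first by rewrite inE eqxx.
have [XY|YX] := totC _ _ CX CY.
  by exists Y => // x; rewrite inE => /orP[/eqP->//|/sX/XY].
by exists X => // x; rewrite inE => /orP[/eqP->|/sX//]; exact: YX.
Qed.

Lemma uniq_fst_split (J : eqType) (s : seq (J * int)) (i : J) :
  uniq (map fst s) -> i \in map fst s ->
  exists k s', [/\ perm_eq s ((i, k) :: s'), i \notin map fst s' & uniq (map fst s')].
Proof.
move=> us /mapP[[j k] xs /= ->]; have ps := perm_to_rem xs.
exists k, (rem (j, k) s); split=> //;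
  by have := us; rewrite (perm_uniq (perm_map fst ps)) => /= /andP[].
Qed.

(** [E] is a maximal direct family in [G0]: if the cyclic group of [g] met its span in 0 only, [g]
    could be adjoined. Nonzero elements can thus be detected through multiples lying in a direct sum
    of cyclic groups. *)
Lemma essential_direct_family (G : zmodType) (G0 : set G) :
  exists E : set G, [/\ E `<=` G0, direct_family E &
    forall g, G0 g -> g <> 0 -> exists (k : int) (s : seq (G * int)),
      [/\ uniq (map fst s), forall x, x \in s -> E x.1, g *~ k = comb id s & g *~ k <> 0]].
Proof.
pose P (E : set G) := E `<=` G0 /\ direct_family E.
have [||E [_ [EG0 dirE] Emax]] := @Zorn_above _ P set0.
- by split=> // -[//|x s] _ /(_ x); rewrite inE eqxx => /(_ isT).
- move=> C C0 CP totC; split; first by move=> x [X /CP[XG _]] /XG.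
  move=> s us sC s0.
  have [X CX sX] := chain_finite_subset C0 totC sC.
  by have [_] := CP _ CX; apply.
exists E; split=> // g G0g g0; apply: contrapT => nsg.
have sing (k : int) s : uniq (map fst s) -> (forall x, x \in s -> E x.1) ->
    g *~ k = comb id s -> g *~ k = 0.
  by move=> us sE gs; apply: contrapT => gk; apply: nsg; exists k, s.
suff Eg : E g.
  apply: g0; have := sing 1 [:: (g, 1)]; rewrite /comb big_seq1 /=; apply=> //.
  by move=> x; rewrite inE => /eqP ->.
apply: (Emax (E `|` [set g])); [by move=> x; left | | by right].
split=> [x [/EG0//|->//]|s us sE s0].
have [gs|gs] := boolP (g \in map fst s); last first.
  apply: dirE => // x xs; have [//|/= xg] := sE _ xs.
  by case/negP: gs; rewrite -xg map_f.
have [k [s' [ps gs' us']]] := uniq_fst_split us gs.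
have s'E x : x \in s' -> E x.1.
  move=> xs'; have [||/= xg] // := sE x; first by rewrite (perm_mem ps) inE xs' orbT.
  by case/negP: gs'; rewrite -xg map_f.
have es : g *~ k + comb id s' = 0.
  by move: s0; rewrite /comb (perm_big _ ps) big_cons.
have gk : g *~ k = 0.
  apply: (sing k (oppc s')); first by rewrite oppc_fst.
    by move=> _ /mapP[y ys' ->] /=; exact: s'E.
  by rewrite comb_opp; apply/eqP; rewrite -addr_eq0 es.
move=> x; rewrite (perm_mem ps) inE => /orP[/eqP -> //|].
by apply: dirE => //; move: es; rewrite gk add0r.
Qed.

Definition has_roots (T : zmodType) : Prop :=
  forall m : nat, (0 < m)%N ->
    exists t : T, forall c : int, t *~ c = 0 <-> (m %| c)%Z.

(** If [g] has finite order, that order serves as [m]. Otherwise only [c = 0] annihilates [g], and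
    $|k|+1$ is too large to divide the nonzero [k]. *)
Lemma annihilator_witness (G : zmodType) (g : G) (k : int) : g *~ k <> 0 ->
  exists2 m, (0 < m)%N & (forall c : int, g *~ c = 0 -> (m %| c)%Z) /\ ~~ (m %| k)%Z.
Proof.
move=> gk; pose P n := (0 < n)%N && (g *+ n == 0).
have [[n0 Pn0]|nP] := pselect (exists n, P n).
  case: (ex_minnP (ex_intro _ n0 Pn0)) => m /andP[m_gt0 /eqP gm] mmin.
  have gc c : g *~ c = g *~ (c %% m)%Z.
    by rewrite {1}(divz_eq c m) mulrzDr mulrC mulrzA -pmulrn gm mul0rz add0r.
  exists m => //; split=> [c|]; last first.
    by apply/negP => /dvdzP[j kj]; apply: gk; rewrite kj mulrC mulrzA -pmulrn gm mul0rz.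
  rewrite gc => gc0; apply/dvdz_mod0P.
  have nz : m%:Z != 0 by rewrite -lt0n.
  have := modz_ge0 c nz; have := ltz_mod c nz.
  case: (c %% m)%Z gc0 => // r gr; rewrite ltz_nat => rn _.
  apply/eqP; rewrite eqz_nat -leqn0 leqNgt; apply/negP => r_gt0.
  have : (m <= r)%N by apply: mmin; rewrite /P r_gt0; apply/eqP.
  by rewrite leqNgt rn.
have free c : g *~ c = 0 -> c = 0.
  move=> gc; apply: contrapT => c0; apply: nP; exists (absz c).
  rewrite /P absz_gt0; apply/andP; split; apply/eqP => //.
  case: c gc {c0} => j //; rewrite NegzE mulrNz => /eqP.
  by rewrite oppr_eq0 => /eqP.
exists (absz k).+1 => //; split=> [c /free ->|]; first exact: dvdz0.
have : k <> 0 by move=> k0; apply: gk; rewrite k0 mulr0z.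
move=> /eqP; rewrite -absz_gt0 => k0; rewrite dvdzE /=; apply/negP.
by move=> /(dvdn_leq k0); rewrite ltnn.
Qed.

Section Characters.
Variable T : zmodType.
Hypotheses (divT : divisible T) (rootT : has_roots T).

(* The label (F, m) selects the members of the direct family matching the finite
   pattern F whose annihilator lies in m Z, and sends them to an element of order m. *)
Lemma separating_characters (G : zmodType) (G0 : set G) (L : Type) (l0 : L)
    (delta : G -> L -> bool) :
  (forall x y, G0 x -> G0 y -> delta x = delta y -> x = y) ->
  exists phi : seq (L * bool) * nat -> {additive G -> T},
    forall g, G0 g -> g <> 0 -> exists l, phi l g <> 0.
Proof.
move=> deltaI; have [E [EG0 dirE Eess]] := essential_direct_family G0.
have /choice[tau tauP] : forall m : nat, exists t : T,
    (0 < m)%N -> forall c : int, t *~ c = 0 <-> (m %| c)%Z.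
  by case=> [|m]; [exists 0 | have [//|t tP] := rootT (m := m.+1); exists t].
pose sel (l : seq (L * bool) * nat) (x : G) :=
  [/\ (forall p, List.In p l.1 -> delta x p.1 = p.2), (0 < l.2)%N &
      forall c : int, x *~ c = 0 -> (l.2 %| c)%Z].
pose v l x : T := if `[< sel l x >] then tau l.2 else 0.
have /choice[phi phiP] : forall l, exists f : {additive G -> T},
    forall x, E x -> f x = v l x.
  move=> l; have [|f [_ fP]] := @family_extension G T G [set 0] \0 E id (v l) divT
    (@trivial_subgroup G); last by exists f.
  move=> _ s -> sE; rewrite /= !add0r -comb_collect => s0.
  rewrite -comb_collect /comb big_seq big1 // => x xs.
  have x0 : x.1 *~ x.2 = 0.
    apply: dirE xs => //; first exact: collect_uniq.
    by move=> y /mem_collect /mapP[z /sE Ez ->].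
  rewrite /v; case: asboolP => [[_ m0 /(_ _ x0)]|_]; last exact: mul0rz.
  by rewrite -tauP.
exists phi => g G0g g0; have [k [s [us sE gs gk]]] := Eess _ G0g g0.
have [x xs x0] : exists2 x, x \in s & x.1 *~ x.2 <> 0.
  apply: contrapT => nx; apply: gk; rewrite gs /comb big_seq big1 // => x xs.
  by apply: contrapT => x0; apply: nx; exists x.
have [m m0 [mann mx]] := annihilator_witness x0.
(* [d y] is a coordinate where [delta] tells [y] from [x.1]; the pattern [F] formed from these
   selects [x.1] and no other member of [s]. *)
have /choice[d dP] : forall y, exists d, E y -> y <> x.1 -> delta y d <> delta x.1 d.
  move=> y; apply: contrapT => nd; have [Ey|Ey] := pselect (E y); last first.
    by apply: nd; exists l0.
  have [yx|yx] := pselect (y = x.1); first by apply: nd; exists l0.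
  apply: yx; apply: deltaI; [exact: EG0 | exact/EG0/sE | apply/funext => d].
  by apply: contrapT => ne; apply: nd; exists d.
pose F := [seq (d y, delta x.1 (d y)) | y <- map fst s].
(* Only the term of [x] survives in the image of [g *~ k], and it is nonzero because [m] does not
   divide [x.2]. *)
exists (F, m) => pg; have : phi (F, m) (g *~ k) = 0 by rewrite raddfMz pg mul0rz.
rewrite gs comb_additive (@eq_comb _ _ _ (v (F, m))); last first.
  by move=> y /sE Ey; exact: phiP.
rewrite /comb (bigD1_seq x) //=; last by apply: map_uniq us.
rewrite big_seq_cond big1 => [|y /andP[ys yx]]; last first.
  rewrite /v; case: asboolP => [[/= sy _ _]|_]; last exact: mul0rz.
  have yx1 : y.1 <> x.1.
    move=> e1; case/negP: yx; apply/eqP.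
    have := us; rewrite (perm_uniq (perm_map fst (perm_to_rem ys))) /= e1 => /andP[+ _].
    have [//|yx] := eqVneq x y.
    by rewrite (_ : x.1 \in _) //; apply: map_f; have := xs;
       rewrite (perm_mem (perm_to_rem ys)) inE (negPf yx).
  case: (dP y.1 (sE _ ys) yx1).
  apply: (sy (d y.1, delta x.1 (d y.1))).
  have : y.1 \in map fst s by apply: map_f.
  rewrite /F; elim: (map fst s) => //= a r IH; rewrite inE => /orP[/eqP ->|/IH]; by [left | right].
rewrite addr0 /v; case: asboolP => [_ /=|nsel _].
  by move=> /(tauP _ m0); apply/negP.
apply: nsel; split=> //= p; rewrite /F; elim: (map fst s) => //= a r IH [<- //|]; exact: IH.
Qed.

(** The code [c] lists countably many labels, the traces of [nu] on them and the values of [f]. If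
    the labels detect every nonzero [nu n], the countable subgroup meets their common kernel [Z]
    trivially, so some homomorphism agrees with [f] on it and vanishes on [Z]. Such a map depends on
    traces alone, and its values along [nu] are read off from [c]. *)
Lemma dense_characters (G : zmodType) (G0 : set G) (L : Type) (l0 : L)
    (phi : L -> {additive G -> T}) :
  is_subgroup G0 -> (forall g, G0 g -> g <> 0 -> exists l, phi l g <> 0) ->
  exists y : (nat -> L) * (nat -> nat -> T) * (nat -> T) -> {additive G -> T},
    forall (nu : nat -> G) (f : {additive G -> T}),
      is_subgroup (range nu) -> (forall n, G0 (nu n)) ->
      exists c, forall n, y c (nu n) = f (nu n).
Proof.
move=> subG0 sepphi.
pose good (c : (nat -> L) * (nat -> nat -> T) * (nat -> T)) (h : {additive G -> T}) :=
  forall g n, G0 g -> (forall k, phi (c.1.1 k) g = c.1.2 n k) -> h g = c.2 n.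
have /choice[y yP] : forall c, exists h, (exists h', good c h') -> good c h.
  by move=> c; have [[h hP]|nh] := pselect (exists h', good c h'); [exists h | exists \0].
exists y => nu f subnu nuG0.
have /choice[s sP] : forall n, exists l, nu n <> 0 -> phi l (nu n) <> 0.
  move=> n; have [->|nz] := pselect (nu n = 0); first by exists l0.
  by have [l lP] := sepphi _ (nuG0 n) nz; exists l.
pose c := (s, fun n k => phi (s k) (nu n), f \o nu).
exists c => n; apply: (yP c) => //.
pose Z : set G := [set z | G0 z /\ forall k, phi (s k) z = 0].
have subZ : is_subgroup Z.
  split; first by split=> [|k]; [case: subG0 | rewrite raddf0].
  move=> a b [G0a a0] [G0b b0]; split=> [|k]; first exact: subgroupB.
  by rewrite raddfB a0 b0 subrr.
have [|h [hN hZ]] := @family_extension G T G (range nu) f Z id (fun=> 0) divT subnu.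
  move=> g r [m _ <-] rZ g0.
  have -> : comb (fun=> (0 : T)) r = 0 by rewrite /comb big1 // => x _; rewrite mul0rz.
  have Zr : Z (comb id r) by apply: subgroup_sum => // x /rZ Zx; exact: (subgroupMz subZ x.2 Zx).
  have nuE : nu m = - comb id r by apply/eqP; rewrite -addr_eq0 g0.
  have [_ Zm] : Z (nu m) by rewrite nuE; exact: subgroupN.
  have -> : nu m = 0 by apply: contrapT => /sP; rewrite Zm.
  by rewrite raddf0 addr0.
exists h => g m G0g gm; rewrite -[g](subrK (nu m)) raddfD (hN (nu m)); last by exists m.
rewrite hZ ?add0r //; split=> [|k]; first exact: subgroupB.
by rewrite raddfB gm subrr.
Qed.

End Characters.

(** * Coefficients with respect to a free family *)

Definition coef (J : eqType) (i : J) (s : seq (J * int)) : int :=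
  \sum_(x <- s | x.1 == i) x.2.

Lemma coef_cat (J : eqType) (i : J) s s' : coef i (s ++ s') = coef i s + coef i s'.
Proof. by rewrite /coef big_cat. Qed.

Lemma coef_scale (J : eqType) (i : J) k s : coef i (scalec k s) = coef i s *+ k.
Proof. by rewrite /coef big_map -sumrMnl. Qed.

Lemma coef_notin (J : eqType) (i : J) s : i \notin map fst s -> coef i s = 0.
Proof.
move=> is'; rewrite /coef big_seq_cond big1 // => x /andP[xs /eqP xi].
by case/negP: is'; rewrite -xi map_f.
Qed.

Lemma comb_coef0 (G : zmodType) (J : eqType) (b : J -> G) s :
  (forall i, i \in map fst s -> coef i s = 0) -> comb b s = 0.
Proof.
move=> s0; rewrite -comb_collect /comb /collect big_map big_seq big1 // => i.
by rewrite mem_undup => /s0 /= si; rewrite [X in _ *~ X]si mulr0z.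
Qed.

Lemma free_coef (G : zmodType) (J : eqType) (b : J -> G) :
  (forall s, uniq (map fst s) -> comb b s = 0 -> forall x, x \in s -> x.2 = 0) ->
  forall s i, comb b s = 0 -> coef i s = 0.
Proof.
move=> free s i; have [is'|/coef_notin ->//] := boolP (i \in map fst s).
rewrite -comb_collect => /(free _ (collect_uniq s)).
by move=> /(_ (i, coef i s)); apply; apply: (map_f (fun j => (j, coef j s))); rewrite mem_undup.
Qed.

(** * Summands with enough characters *)

Section Nice.
Variable T : zmodType.
Hypotheses (divT : divisible T) (rootT : has_roots T).

(* [nice p]: the image of the projection [p] carries a family of characters that
   maps it onto every countable subproduct of the torsion groups T[k x] (T itself if
   k x = 0) and realises, by finite sums, all characters of its countable subgroups. *)
Definition nice (G : zmodType) (p : {additive G -> G}) : Prop :=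
  exists (X : Type) (k : X -> nat) (chi : X -> {additive G -> T}),
  [/\ forall x g, chi x g *+ k x = 0,
      forall x g, chi x (p g) = chi x g,
      forall (c : nat -> option X) (t : X -> T), (forall x, t x *+ k x = 0) ->
        exists2 g, p g = g & forall n x, c n = Some x -> chi x g = t x &
      forall (nu : nat -> G) (f : {additive G -> T}), is_subgroup (range nu) ->
        (forall n, p (nu n) = nu n) ->
        exists xs : seq X, forall n, \sum_(x <- xs) chi x (nu n) = f (nu n)].

Lemma range_comp_subgroup (G M : zmodType) (f : {additive G -> M}) (nu : nat -> G) :
  is_subgroup (range nu) -> is_subgroup (range (f \o nu)).
Proof. by move=> /(additive_subgroup_image f); rewrite image_comp. Qed.

(** The two families are put side by side. As [p] and [q] annihilate each other, each family
    vanishes on the image of the other projection, so realisations simply add up. *)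
Lemma nice_add (G : zmodType) (p q r : {additive G -> G}) :
  (forall g, p (p g) = p g) -> (forall g, q (q g) = q g) ->
  (forall g, p (q g) = 0) -> (forall g, q (p g) = 0) ->
  (forall g, r g = p g + q g) -> nice p -> nice q -> nice r.
Proof.
move=> pp qq pq qp rE [X [k [chi [kchi chip rowX colX]]]].
move=> [Y [l [psi [lpsi psiq rowY colY]]]].
pose rho (z : X + Y) : {additive G -> T} :=
  match z with inl x => chi x | inr y => psi y end.
pose m (z : X + Y) := match z with inl x => k x | inr y => l y end.
have chiq x g : chi x (q g) = 0 by rewrite -chip pq raddf0.
have psip y g : psi y (p g) = 0 by rewrite -psiq qp raddf0.
exists (X + Y)%type, m, rho; split.
- by case.
- by case=> z g /=; rewrite rE raddfD ?chip ?chiq ?psip ?psiq ?addr0 ?add0r.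
- move=> c t mt.
  have [g1 pg1 g1P] := rowX (fun n => if c n is Some (inl x) then Some x else None)
    (t \o inl) (fun x => mt (inl x)).
  have [g2 qg2 g2P] := rowY (fun n => if c n is Some (inr x) then Some x else None)
    (t \o inr) (fun x => mt (inr x)).
  exists (g1 + g2).
    have pg2 : p g2 = 0 by rewrite -qg2 pq.
    have qg1 : q g1 = 0 by rewrite -pg1 qp.
    by rewrite rE !raddfD pg1 qg2 pg2 qg1 addr0 add0r.
  move=> n [x|y] cn /=; rewrite raddfD.
    by rewrite -[g2]qg2 chiq addr0 (g1P n) ?cn.
  by rewrite -[g1]pg1 psip add0r (g2P n) ?cn.
- move=> nu f subnu rnu.
  have [xs xsP] := colX _ f (range_comp_subgroup p subnu) (fun n => pp _).
  have [ys ysP] := colY _ f (range_comp_subgroup q subnu) (fun n => qq _).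
  exists (map inl xs ++ map inr ys) => n.
  rewrite big_cat !big_map /= -[in RHS]rnu rE raddfD; congr (_ + _).
    by rewrite -xsP; apply: eq_bigr => x _; rewrite /= chip.
  by rewrite -ysP; apply: eq_bigr => y _; rewrite /= psiq.
Qed.

(** A purification: these elements of [G0] depend, up to torsion, only on the coordinates in [P].
    For a difference the product of the two multipliers serves. *)
Lemma purification_subgroup (G : zmodType) (G0 : set G) (J : eqType) (b : J -> G)
    (P : set J) : is_subgroup G0 ->
  is_subgroup [set g | G0 g /\ exists k s, [/\ (0 < k)%N,
    forall x, x \in s -> P x.1 & g *+ k = comb b s]].
Proof.
move=> subG0; split.
  by split; [case: subG0 | exists 1%N, [::]; rewrite /comb big_nil].
move=> g g' [G0g [k [s [k0 sP gs]]]] [G0g' [k' [s' [k'0 s'P gs']]]].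
split; first exact: subgroupB.
exists (k * k')%N, (scalec k' s ++ oppc (scalec k s')); split.
- by rewrite muln_gt0 k0.
- move=> x; rewrite mem_cat => /orP[/mapP[y /sP Py ->]//|/mapP[y /mapP[z /s'P Pz ->] ->]//].
- by rewrite comb_cat comb_opp !comb_scale -gs -gs' -!mulrnA mulrnBl [(k' * k)%N]mulnC.
Qed.

(* The column (c, S) follows the dense character c on the elements depending only
   on coordinates outside [iota (Q \ S)], and the matrix on the other coordinates. *)
Lemma nice_of_free_family (G : zmodType) (p : {additive G -> G}) (J : eqType)
    (b : J -> G) (Q L : Type) (l0 : L) (delta : G -> L -> bool) :
  (forall g, p (p g) = p g) ->
  (forall j, p (b j) = b j) ->
  (forall s, uniq (map fst s) -> comb b s = 0 -> forall x, x \in s -> x.2 = 0) ->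
  (forall g, p g = g -> exists k s, (0 < k)%N /\ g *+ k = comb b s) ->
  absorbing Q -> emb Q J -> emb T Q -> emb L (Q -> bool) ->
  (forall x y, p x = x -> p y = y -> delta x = delta y -> x = y) ->
  nice p.
Proof.
move=> pp pb free span absQ [iota iotaI] TQ LQ deltaI.
pose G0 : set G := [set g | p g = g].
have subG0 : is_subgroup G0.
  by split=> [|x y]; rewrite /G0 /= ?raddf0 // raddfB => -> ->.
have [phi phiP] := separating_characters divT rootT l0 deltaI.
have [y yP] := dense_characters divT ([::], 0%N) subG0 phiP.
set C := (_ * _ * _)%type in y yP.
have [q0 _] := absorbing_inhabited absQ.
have [iota' iotaK] := emb_left_inverse q0 iotaI.
pose X := (C * (nat -> Q))%type.
have absP := absorbing_pow absQ.
have XQ : emb X (Q -> bool).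
  have QP := @emb_singletons Q; have TP := emb_trans TQ QP.
  have sP := absorbing_sequences absP.
  apply: (absorbing_prod absP) (sP _ QP); apply: (absorbing_prod absP) (sP _ TP).
  apply: (absorbing_prod absP) (sP _ (sP _ TP)); apply: sP.
  apply: (absorbing_prod absP); last exact: absorbing_nat.
  exact/(absorbing_list absP)/(absorbing_prod absP LQ)/absorbing_bool.
have [M MP] := pattern_matrix (0 : T) absQ XQ TQ.
pose in_S (x : X) : set J := [set j | forall w, j = iota w -> exists n, w = x.2 n].
pose pure (x : X) : set G := [set g | G0 g /\ exists k s, [/\ (0 < k)%N,
    forall z, z \in s -> in_S x z.1 & g *+ k = comb b s]].
have /choice[psi psiP] : forall x : X, exists f : {additive G -> T},
    (forall g, pure x g -> f g = y x.1 g) /\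
    (forall w, (forall n, w <> x.2 n) -> f (b (iota w)) = M x w).
  move=> x; have [|f [f1 f2]] := @family_extension G T J (pure x) (y x.1)
      (~` in_S x) b (M x \o iota') divT (purification_subgroup b (in_S x) subG0).
    move=> g s [_ [k [s' [k0 s'S gs']]]] sS gs.
    (* Multiplied by [k], the relation becomes one between coordinates inside and outside [in_S x];
       freeness kills the outside coefficients. *)
    have s0 i : i \in map fst s -> coef i s = 0.
      move=> /mapP[z zs ->]; have nz := sS _ zs.
      have : coef z.1 (s' ++ scalec k s) = 0.
        apply: (free_coef free); rewrite comb_cat comb_scale -gs' -mulrnDl gs.
        exact: mul0rn.
      rewrite coef_cat coef_scale coef_notin ?add0r; last first.
        by apply/negP => /mapP[z' /s'S + e]; rewrite -e.
      by move=> /eqP; rewrite mulrn_eq0 -[k == 0%N]negbK -lt0n k0 => /eqP.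
    rewrite comb_coef0 // addr0; move: gs; rewrite comb_coef0 // addr0 => ->.
    exact: raddf0.
  exists f; split=> // w wS; rewrite f2 /= ?iotaK // => /(_ w erefl)[n wn].
  exact: (wS n).
exists X, (fun=> 0%N), (fun x => psi x \o p); split=> //.
- by move=> x g /=; rewrite pp.
- move=> c t _.
  have x0 : X := (fun=> ([::], 0%N), fun _ _ => 0, fun=> 0, fun=> q0).
  (* A character follows the matrix at [b (iota w)] only if [w] lies outside its set [S], so [w] has
     to avoid the sets of all columns in the pattern. *)
  have [w [wz wP]] := MP (fun n => odflt x0 (c n)) t
    (fun k => (odflt x0 (c (unpair k).1)).2 (unpair k).2).
  exists (b (iota w)) => // n x cn /=; rewrite pb.
  have [_ ->] := psiP x; first by have := wP n; rewrite cn.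
  by move=> m; have := wz (pickle (n, m)); rewrite /= unpairK /= cn.
- move=> nu f subnu pnu; have [c cP] := yP nu f subnu pnu.
  have /choice[s sP] : forall n, exists s, exists2 k, (0 < k)%N & nu n *+ k = comb b s.
    by move=> n; have [k [s [k0 ks]]] := span _ (pnu n); exists s, k.
  (* [S] covers every [w] whose coordinate [iota w] occurs in the chosen multiple of some [nu n];
     hence all [nu n] lie in the purification on which the column [(c, S)] equals the dense
     character [y c]. *)
  pose S k := iota' (nth (iota q0) (map fst (s (unpair k).1)) (unpair k).2).
  exists [:: (c, S)] => n; rewrite big_seq1 /= pnu -cP.
  have [-> //] := psiP (c, S); split; first exact: pnu.
  have [k k0 ks] := sP n; exists k, (s n); split=> // z zs w zw.
  exists (pickle (n, index z.1 (map fst (s n)))).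
  by rewrite /= /S unpairK /= nth_index ?map_f // zw iotaK.
Qed.

End Nice.

(** * Direct decompositions *)

Section Decomposition.
Variables (G : zmodType) (P0 : seq nat) (I : eqType) (ord : I -> nat) (e : I -> G)
  (H : set G).
Hypothesis dec : decomposition P0 ord e H.

Lemma decomposition_hom (M : zmodType) (t : I -> M) (eta : {additive G -> M}) :
  (forall i, t i *+ ord i = 0) ->
  exists f : {additive G -> M}, (forall i, f (e i) = t i) /\ (forall h, H h -> f h = eta h).
Proof.
case: dec => _ _ subH span uniqd tord.
pose F : set (G * M) := [set z | exists s h, H h /\ z = (comb e s + h, comb t s + eta h)].
have subF : is_subgroup F.
  split; first by exists [::], 0; split; [case: subH | rewrite /comb !big_nil raddf0 !addr0].
  move=> _ _ [s [h [Hh ->]]] [s' [h' [Hh' ->]]].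
  exists (s ++ oppc s'), (h - h'); split; first exact: subgroupB.
  rewrite !comb_cat !comb_opp raddfB -[LHS]/(_ - _, _ - _).
  by congr (_, _); rewrite opprD addrACA.
have funF : functional F.
  move=> m [s [h [Hh [/esym sh0 ->]]]].
  have [|h0 s0] := uniqd (collect s) h (collect_uniq s) Hh; first by rewrite comb_collect.
  rewrite h0 raddf0 addr0 -comb_collect /comb big_seq big1 // => x /s0 /dvdzP[k ->].
  by rewrite mulrC mulrzA -pmulrn tord mul0rz.
have totF g : exists m, F (g, m).
  have [s [h [Hh ->]]] := span g.
  by exists (comb t s + eta h), s, h.
have [f fP] := additive_of_graph subF funF totF.
exists f; split=> [i|h Hh]; apply: fP.
  exists [:: (i, 1)], 0; split; first by case: subH.
  by rewrite /comb !big_seq1 raddf0 !addr0.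
by exists [::], h; split=> //; rewrite /comb !big_nil !add0r.
Qed.

Lemma decomposition_eq (M : zmodType) (f f' : {additive G -> M}) :
  (forall i, f (e i) = f' (e i)) -> (forall h, H h -> f h = f' h) -> f =1 f'.
Proof.
case: dec => _ _ _ span _ fe fH g; have [s [h [Hh ->]]] := span g.
by rewrite !raddfD !comb_additive fH //; congr (_ + _); apply: eq_comb => x _ /=.
Qed.

Definition is_projection (u : I -> bool) (v : bool) (p : {additive G -> G}) : Prop :=
  (forall i, p (e i) = if u i then e i else 0) /\
  (forall h, H h -> p h = if v then h else 0).

Lemma projection_exists u v : exists p, is_projection u v p.
Proof.
have ordK i : (if u i then e i else 0) *+ ord i = 0.
  by case: dec => _ ek _ _ _; case: ifP => _; rewrite ?ek ?mul0rn.
have [p [pe pH]] := @decomposition_hom G _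
  (if v then idfun : {additive G -> G} else \0) ordK.
by exists p; split=> // h /pH ->; case: v {pH}.
Qed.

Lemma projection_comp u v p u' v' p' u'' v'' p'' :
  is_projection u v p -> is_projection u' v' p' -> is_projection u'' v'' p'' ->
  (forall i, u'' i = u i && u' i) -> v'' = v && v' ->
  forall g, p (p' g) = p'' g.
Proof.
move=> [pe pH] [pe' pH'] [pe'' pH''] uu vv.
apply: (@decomposition_eq G (p \o p') p'') => [i|h Hh] /=.
  by rewrite pe' pe'' uu; case: (u' i); rewrite ?andbF ?raddf0 // andbT pe.
by rewrite pH' // pH'' // vv; case: v' {pH' vv}; rewrite ?andbF ?raddf0 // andbT pH.
Qed.

Lemma projection_idem u v p : is_projection u v p -> forall g, p (p g) = p g.
Proof. by move=> pP; apply: (projection_comp pP pP pP) => [i|]; rewrite andbb. Qed.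

Lemma projection_orthogonal u v p u' v' p' :
  is_projection u v p -> is_projection u' v' p' ->
  (forall i, u i && u' i = false) -> v && v' = false -> forall g, p (p' g) = 0.
Proof.
move=> pP pP' uu vv g.
have P00 : is_projection xpred0 false \0 by [].
by rewrite (projection_comp pP pP' P00).
Qed.

Lemma projection_add u v p u' v' p' u'' v'' p'' :
  is_projection u v p -> is_projection u' v' p' -> is_projection u'' v'' p'' ->
  (forall i, u i && u' i = false) -> v && v' = false ->
  (forall i, u'' i = u i || u' i) -> v'' = v || v' ->
  forall g, p'' g = p g + p' g.
Proof.
move=> [pe pH] [pe' pH'] [pe'' pH''] uu vv ou ov.
apply: (@decomposition_eq G p'' (p \+ p')) => [i|h Hh] /=.
  rewrite pe pe' pe'' ou; have := uu i.
  by case: (u i); case: (u' i); rewrite ?addr0 ?add0r.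
rewrite pH // pH' // pH'' // ov; move: vv.
by case: v {pH ov}; case: v' {pH'}; rewrite ?addr0 ?add0r.
Qed.

Lemma partial_sum_projection (P : nat -> Prop) p :
  is_projection (fun i => `[< P (ord i) >]) true p ->
  forall g, partial_sum ord e H P g <-> p g = g.
Proof.
move=> [pe pH] g; split=> [[s [h [Hh [sP ->]]]]|<-].
  rewrite raddfD comb_additive (pH _ Hh); congr (_ + _); apply: eq_comb => x /sP Px /=.
  by rewrite pe asboolT.
case: dec => _ _ _ span _; have [s [h [Hh ->]]] := span g.
exists [seq x <- s | `[< P (ord x.1) >]], h; split=> //; split.
  by move=> x; rewrite mem_filter => /andP[/asboolP].
rewrite raddfD comb_additive (pH _ Hh); congr (_ + _).
rewrite /comb big_filter [RHS]big_mkcond; apply: eq_bigr => x _ /=.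
by rewrite pe; case: ifP => _; rewrite ?mul0rz.
Qed.

Lemma ord_gt0 i : (0 < ord i)%N.
Proof.
case: dec => [[pp iP] _ _ _ _]; have [p [k [pr [_ ->]]]] := pp _ (iP i).
by rewrite expn_gt0 prime_gt0.
Qed.

Lemma comb_torsion (b : I -> G) (s : seq (I * int)) :
  (forall i, b i *+ ord i = 0) -> exists2 n, (0 < n)%N & comb b s *+ n = 0.
Proof.
move=> bo; elim: s => [|x s [n n0 IH]]; first by exists 1%N; rewrite // /comb big_nil.
exists (n * ord x.1)%N; first by rewrite muln_gt0 n0 ord_gt0.
rewrite /comb big_cons mulrnDl [in X in _ + X]mulrnA [X in _ + X *+ _]IH mul0rn addr0.
have bx : b x.1 *~ x.2 *+ ord x.1 = 0 by rewrite pmulrn mulrzAC -pmulrn bo mul0rz.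
by rewrite mulnC mulrnA bx mul0rn.
Qed.

(** What [p] removes is spanned by cyclic summands of finite order, and only finitely many of them
    occur in [g]. *)
Lemma projection_cotorsion u p g : is_projection u true p ->
  exists2 n, (0 < n)%N & (g - p g) *+ n = 0.
Proof.
move=> [pe pH]; case: dec => _ ek _ span _; have [s [h [Hh ->]]] := span g.
have [|n n0 sn] := @comb_torsion (fun i => e i - p (e i)) s.
  by move=> i; rewrite mulrnBl ek -raddfMn ek raddf0 subrr.
exists n => //; rewrite raddfD (pH _ Hh) opprD addrACA subrr addr0 comb_additive.
rewrite -[RHS]sn; congr (_ *+ n); rewrite /comb -sumrB.
by apply: eq_bigr => x _ /=; rewrite mulrzBl.
Qed.

(** The two-sided matrix takes values in the [q]-torsion of [T]; its rows are generators [e i], its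
    columns characters. A pattern along a row is realised by one generator, and a homomorphism on a
    countable subgroup, which involves countably many generators, by one character. *)
Lemma nice_cyclic_summand (T : zmodType) (q : nat) p :
  emb T (nat -> bool) -> star [set i | ord i = q] ->
  is_projection (fun i => ord i == q) false p -> nice T p.
Proof.
move=> Tb [K /star_with_absorbing [absQ QI IQ]] pP.
set Q := nat -> K in absQ QI IQ.
pose V := {t : T | t *+ q = 0}.
have v0 : V by exists 0; rewrite mul0rn.
have VQ : emb V Q.
  apply: (@emb_trans _ T); last exact: emb_trans Tb (absorbing_sequences absQ (absorbing_bool absQ)).
  by exists sval => -[x hx] [y hy] /= xy; exact: eq_exist.
have [M [Mcol Mrow]] := two_sided_matrix v0 absQ IQ QI VQ.
pose val_at x i : T :=
  match pselect (ord i = q) with left h => sval (M (exist _ i h) x) | right _ => 0 end.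
have val_atE x i (h : ord i = q) : val_at x i = sval (M (exist _ i h) x).
  by rewrite /val_at; case: pselect => // h'; rewrite (Prop_irrelevance h h').
have val_atN x i : ord i <> q -> val_at x i = 0 by rewrite /val_at; case: pselect.
have /choice[chi chiP] : forall x, exists f : {additive G -> T},
    (forall i, f (e i) = val_at x i) /\ (forall h, H h -> f h = 0).
  move=> x; have [|f [fe fH]] := @decomposition_hom T (val_at x) \0; last by exists f.
  move=> i; have [h|/val_atN ->] := pselect (ord i = q); last exact: mul0rn.
  by rewrite (val_atE _ _ h) {1}h; exact: (svalP (M _ x)).
have chie x i : chi x (e i) = val_at x i by have [] := chiP x.
have chiH x h : H h -> chi x h = 0 by have [_] := chiP x; apply.
have [q0 _] := absorbing_inhabited absQ.
have [pe pH] := pP.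
have chip x g : chi x (p g) = chi x g.
  apply: (@decomposition_eq _ (chi x \o p) (chi x)) => [i|h Hh] /=.
    by rewrite pe; case: eqP => // /val_atN; rewrite raddf0 chie.
  by rewrite pH // raddf0 chiH.
exists Q, (fun=> q), chi; split=> //.
- move=> x g; case: dec => _ ek _ span _; have [s [h [Hh ->]]] := span g.
  rewrite raddfD (chiH _ _ Hh) addr0 comb_additive -comb_scale /comb big_map big1 // => y _ /=.
  rewrite chie [_ *+ q]pmulrn mulrzz mulrC mulrzA -pmulrn.
  have [h'|/val_atN ->] := pselect (ord y.1 = q); last by rewrite mul0rn mul0rz.
  by rewrite (val_atE _ _ h') (svalP (M _ x)) mul0rz.
- move=> c t tq.
  have [[i iq] iP] := Mrow (fun n => odflt q0 (c n)) (fun x => exist _ (t x) (tq x) : V).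
  exists (e i); first by rewrite pe /= iq eqxx.
  by move=> n x cn; rewrite chie (val_atE _ _ iq); have := iP n; rewrite cn /= => ->.
- move=> nu f subnu pnu; case: dec => _ ek _ span _.
  have /choice[s sP] : forall n, exists s, exists2 h, H h & nu n = comb e s + h.
    by move=> n; have [s [h [Hh nE]]] := span (nu n); exists s, h.
  have [[i0 i0q] _] := Mrow (fun=> q0) (fun=> v0).
  (* [c] enumerates the generators of order [q] in the expressions of the [nu n]. The others vanish
     under [p], so they may be replaced by the default [i0]. *)
  pose c k : {i | ord i = q} :=
    let i := nth i0 (map fst (s (unpair k).1)) (unpair k).2 in
    match pselect (ord i = q) with left h => exist _ i h | right _ => exist _ i0 i0q end.
  have fq (i : {i | ord i = q}) : f (e (sval i)) *+ q = 0.
    by case: i => i /= <-; rewrite -raddfMn ek raddf0.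
  have [x xP] := Mcol c (fun i => exist _ (f (e (sval i))) (fq i) : V).
  exists [:: x] => n; rewrite big_seq1 -chip -[in RHS]pnu; have [h Hh ->] := sP n.
  rewrite !raddfD (pH _ Hh) !raddf0 !addr0 !comb_additive.
  apply: eq_comb => y ys /=; rewrite pe; case: eqP => [yq|_]; last by rewrite !raddf0.
  rewrite chie (val_atE _ _ yq).
  have := xP (pickle (n, index y.1 (map fst (s n)))).
  rewrite /c unpairK /= nth_index ?map_f //; case: pselect => // yq'.
  by rewrite (Prop_irrelevance yq' yq) => ->.
Qed.

End Decomposition.

(** If no positive multiple of [g] were a combination of [A], adjoining [g] would keep [A]
    independent, against maximality. *)
Lemma max_independent_span (G : zmodType) (A : set G) : max_independent A ->
  forall g, exists k (s : seq ({x | x \in A} * int)),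
    (0 < k)%N /\ g *+ k = comb val s.
Proof.
move=> [indA maxA] g; apply: contrapT => ng.
have lift (s : seq (G * int)) : (forall x, x \in s -> A x.1) ->
    exists s' : seq ({x | x \in A} * int), comb id s = comb val s'.
  elim: s => [|[x k] s IH] sA; first by exists [::]; rewrite /comb !big_nil.
  have [|s' ss'] := IH; first by move=> z zs; apply: sA; rewrite inE zs orbT.
  have Ax : A x by apply: (sA (x, k)); rewrite inE eqxx.
  exists ((exist _ x (mem_set Ax), k) :: s').
  by rewrite /comb !big_cons /= -[X in _ + X = _]/(comb id s) ss'.
have ngs (k : int) s : (forall x, x \in s -> A x.1) -> g *~ k = comb id s -> k = 0.
  move=> sA gk; apply: contrapT => /eqP k0.
  wlog k_gt0 : k s sA gk k0 / 0 < k.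
    move=> wl; have [k_gt0|] := ltP 0 k; first exact: (wl k s).
    rewrite le_eqVlt (negPf k0) /= => k_lt0; apply: (wl (- k) (oppc s)).
    - by move=> _ /mapP[y /sA Ay ->].
    - by rewrite comb_opp mulrNz gk.
    - by rewrite oppr_eq0.
    - by rewrite oppr_gt0.
  have [s' ss'] := lift _ sA; apply: ng; exists (absz k), s'; split.
    by rewrite absz_gt0.
  by rewrite pmulrn gtz0_abs // -ss'.
suff Ag : A g.
  have // : (1 : int) = 0.
  apply: (@ngs 1 [:: (g, 1)]); last by rewrite /comb big_seq1.
  by move=> x; rewrite inE => /eqP ->.
rewrite -(maxA (A `|` [set g])); [by right | | by move=> x; left].
move=> s us sA s0; have {}s0 : comb id s = 0 by [].
have [gs|gs] := boolP (g \in map fst s); last first.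
  apply: indA => // x xs; have [//|/= xg] := sA _ xs.
  by case/negP: gs; rewrite -xg map_f.
have [k [s' [ps gs' us']]] := uniq_fst_split us gs.
have s'A x : x \in s' -> A x.1.
  move=> xs'; have [||/= xg] // := sA x; first by rewrite (perm_mem ps) inE xs' orbT.
  by case/negP: gs'; rewrite -xg map_f.
have es : g *~ k + comb id s' = 0.
  by move: s0; rewrite /comb (perm_big _ ps) big_cons.
have k0 : k = 0.
  apply: (@ngs k (oppc s')); first by move=> _ /mapP[y /s'A Ay ->].
  by rewrite comb_opp; apply/eqP; rewrite -addr_eq0 es.
move=> x; rewrite (perm_mem ps) inE => /orP[/eqP -> //|].
by apply: indA => //; move: es; rewrite k0 mulr0z add0r.
Qed.

(** * The circle group *)

Definition is_intb : {pred R} := fun x => `[< is_int x >].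

Lemma is_intb_zmod_closed : zmod_closed is_intb.
Proof.
split=> [|x y]; first by apply/asboolP; exists BinNums.Z0.
move=> /asboolP[a ->] /asboolP[b ->]; apply/asboolP; exists (BinInt.Z.sub a b).
by rewrite minus_IZR.
Qed.

HB.instance Definition _ := GRing.isZmodClosed.Build R is_intb is_intb_zmod_closed.

Definition circle : zmodType := Quotient.quot (is_intb : zmodClosed R).

Definition toT (x : R) : circle := (\pi_(Quotient.quot (is_intb : zmodClosed R)) x)%qT.

Definition ofT (t : circle) : R := repr t.

Lemma ofTK t : toT (ofT t) = t.
Proof. exact: reprK. Qed.

Lemma toTD x y : toT (Rplus x y) = toT x + toT y.
Proof. by rewrite /toT (Quotient.pi_add (is_intb : zmodClosed R) x y). Qed.

Lemma toTN x : toT (Ropp x) = - toT x.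
Proof. by rewrite /toT (Quotient.pi_opp (is_intb : zmodClosed R) x). Qed.

Lemma toTB x y : toT (Rminus x y) = toT x - toT y.
Proof. by rewrite toTD toTN. Qed.

Lemma toT_eq0 x : toT x = 0 <-> is_int x.
Proof.
have E : (x - 0 \in (is_intb : zmodClosed R)) = (toT x == toT 0).
  by rewrite Quotient.idealrBE.
have T0 : toT 0 = 0 by rewrite -(Rminus_diag_eq 0 0 erefl) toTB subrr.
rewrite T0 subr0 in E; split=> [/eqP|xi].
  by rewrite -E => /asboolP.
by apply/eqP; rewrite -E; apply/asboolP.
Qed.

Lemma toTMn x n : toT x *+ n = toT (x *+ n).
Proof.
elim: n => [|n IH]; last by rewrite !mulrS IH -toTD.
by apply/esym/toT_eq0; exists BinNums.Z0.
Qed.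

Lemma toTMz x (k : int) : toT x *~ k = toT (x *~ k).
Proof. by case: k => n; rewrite ?NegzE ?mulrNz -!pmulrn toTMn // -toTN. Qed.

Lemma IZR_intr z : exists k : int, IZR z = k%:~R.
Proof.
case: z => [|p|p]; first by exists 0.
  by exists (nat_of_pos p)%:Z; rewrite IZRposE INRE pmulrn.
exists (- (nat_of_pos p)%:Z).
by rewrite -[BinNums.Zneg p]/(BinInt.Z.opp (BinNums.Zpos p)) opp_IZR IZRposE INRE mulrNz.
Qed.

Lemma divisible_circle : divisible circle.
Proof.
move=> n t n0; exists (toT (ofT t / n%:R)); rewrite toTMn -[RHS]ofTK; congr toT.
by rewrite -[_ *+ n]mulr_natr divfK // pnatr_eq0 -lt0n.
Qed.

Lemma has_roots_circle : has_roots circle.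
Proof.
move=> m m0; exists (toT (m%:R^-1)) => c.
have m0R : (m%:R : R) != 0 by rewrite pnatr_eq0 -lt0n.
rewrite toTMz toT_eq0; split=> [[z]|/dvdzP[k ->]].
  have [k ->] := IZR_intr z; rewrite -mulrzl => ck; apply/dvdzP; exists k.
  apply: (@intr_inj R); rewrite rmorphM /= -ck -[X in _ = X * _]/(_ / _).
  by rewrite -[X in _ * X]/(m%:R) divfK.
apply/toT_eq0; rewrite -toTMz mulrC mulrzA -pmulrn toTMn -[_ *+ m]mulr_natr mulVf //.
suff -> : toT 1 = 0 by rewrite mul0rz.
by apply/toT_eq0; exists (BinNums.Zpos BinNums.xH).
Qed.

Lemma emb_circle : emb circle (nat -> bool).
Proof.
apply: (@emb_trans _ R); first by exists ofT; exact: can_inj ofTK.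
pose cut (x : R) (n : nat) :=
  if @unpickle rat n is Some q then (ratr q < x)%R else false.
have cutE x q : cut x (pickle q) = (ratr q < x) by rewrite /cut pickleK.
exists cut => x y xy; wlog lt_xy : x y xy / x < y.
  by move=> wl; have [/wl->|/wl->|] := ltgtP x y.
have [q /andP[xq qy]] : exists q : rat, (x < ratr q) && (ratr q < y).
  by have [q] := rat_in_itvoo lt_xy; rewrite in_itv; exists q.
have : cut x (pickle q) = cut y (pickle q) by rewrite xy.
by rewrite !cutE qy ltNge (ltW xq).
Qed.

Definition near0 (eps : R) (t : circle) : Prop := exists2 r, toT r = t & Rlt (Rabs r) eps.

Lemma near0_0 eps : Rlt 0 eps -> near0 eps 0.
Proof. by move=> e0; exists R0; [apply/toT_eq0; exists BinNums.Z0 | rewrite Rabs_R0]. Qed.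

Lemma near0D a b t u : near0 a t -> near0 b u -> near0 (Rplus a b) (t + u).
Proof.
move=> [r <- ra] [s <- sb]; exists (Rplus r s); first exact: toTD.
by have := Rabs_triang r s; lra.
Qed.

Lemma near0N a t : near0 a t -> near0 a (- t).
Proof. by move=> [r <- ra]; exists (Ropp r); rewrite ?toTN ?Rabs_Ropp. Qed.

Lemma near0_le a b t : Rle a b -> near0 a t -> near0 b t.
Proof. by move=> ab [r <- ra]; exists r => //; lra. Qed.

Lemma near0B_half a t u : near0 (Rdiv a 2) t -> near0 (Rdiv a 2) u -> near0 a (t - u).
Proof. by move=> tn /near0N un; apply: near0_le (near0D tn un); lra. Qed.

Lemma toT_frac t : exists2 x, toT x = t & Rle 0 x /\ Rlt x 1.
Proof.
exists (frac_part (ofT t)); last by have := base_fp (ofT t); lra.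
rewrite /frac_part toTB ofTK (_ : toT (IZR _) = 0) ?subr0 //.
by apply/toT_eq0; exists (Int_part (ofT t)).
Qed.

Lemma near0_separated t : t <> 0 -> exists2 eps, Rlt 0 eps & ~ near0 eps t.
Proof.
move=> t0; have [x xt [x0 x1]] := toT_frac t.
have {}x0 : Rlt 0 x.
  case: x0 => // x0; case: t0; rewrite -xt -x0; apply/toT_eq0; by exists BinNums.Z0.
(* A lift of [t] differs from [x] by an integer, and integers are at distance at least $\min(x,1-x)$
   from a point [x] strictly between 0 and 1. *)
exists (Rmin x (Rminus 1 x)); first by apply: Rmin_glb_lt; lra.
move=> [r rt rlt]; have /toT_eq0[z xz] : toT (Rminus x r) = 0 by rewrite toTB xt rt subrr.
have := Rmin_l x (Rminus 1 x); have := Rmin_r x (Rminus 1 x).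
have := Rle_abs r; have := Rle_abs (Ropp r); rewrite Rabs_Ropp => ? ? ? ?.
have z0 : BinInt.Z.lt 0 z by apply: lt_IZR; lra.
have z1 : BinInt.Z.lt z 1 by apply: lt_IZR; lra.
by have := BinInt.Z.le_succ_l 0 z; have := BinInt.Z.lt_irrefl 1; Lia.lia.
Qed.

Lemma near0_scale k eps : Rlt 0 eps ->
  exists2 d, Rlt 0 d & forall t, near0 d t -> near0 eps (t *+ k).
Proof.
elim: k eps => [|k IH] eps e0; first by exists R1 => [|t _]; [lra | exact: near0_0].
have [|d d0 dP] := IH (Rdiv eps 2); first by lra.
exists (Rmin d (Rdiv eps 2)); first by apply: Rmin_glb_lt; lra.
move=> t tn; rewrite mulrS; apply: (@near0_le (Rplus (Rdiv eps 2) (Rdiv eps 2))); first by lra.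
apply: near0D; first by apply: near0_le tn; exact: Rmin_r.
by apply: dP; apply: near0_le tn; exact: Rmin_l.
Qed.

(** * Ultralimits in the circle *)

Section UltraLimit.
Variable U : set_system nat.
Hypothesis ultraU : UltraFilter U.

Let filterU : Filter U := @filter_filter _ _ (@ultra_proper _ _ ultraU).

(** With representatives $x_n$ in $[0,1)$, the limit is the class of the supremum [m] of the reals
    [r] such that $r\le x_n$ for [U]-almost all [n]. *)
Lemma ultra_limit (t : nat -> circle) :
  exists l, forall eps, Rlt 0 eps -> U [set n | near0 eps (t n - l)].
Proof.
have /choice[x xP] : forall n, exists x, toT x = t n /\ (Rle 0 x /\ Rlt x 1).
  by move=> n; have [x] := toT_frac (t n); exists x.
pose S r := U [set n | Rle r (x n)].
have Sb : bound S.
  exists R1 => r Sr; apply: contrapT => r1.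
  have [n /= rn] : [set n | Rle r (x n)] !=set0 by exact: (@filter_ex _ _ (@ultra_proper _ _ ultraU)).
  by have [_ ?] := xP n; lra.
have S0 : exists r, S r.
  by exists R0; apply: filterS filterT => n _ /=; have [_ []] := xP n.
have [m [mub mlub]] := completeness S Sb S0.
exists (toT m) => eps e0.
have Uhi : U [set n | Rlt (x n) (Rplus m eps)].
  have [Sr|] := @in_ultra_setVsetC _ U [set n | Rle (Rplus m eps) (x n)] ultraU.
    by have := mub _ Sr; lra.
  by apply: filterS => n /= nr; lra.
have [r [Sr rm]] : exists r, S r /\ Rlt (Rminus m eps) r.
  apply: contrapT => nr; suff : Rle m (Rminus m eps) by lra.
  apply: mlub => r Sr; apply: Rnot_lt_le => rm; apply: nr; by exists r.
apply: filterS (filterI Uhi Sr) => n [/= hi lo].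
exists (Rminus (x n) m); first by rewrite toTB; have [->] := xP n.
by apply: Rabs_def1; lra.
Qed.

Lemma ultra_limit_torsion (t : nat -> circle) l k : (forall n, t n *+ k = 0) ->
  (forall eps, Rlt 0 eps -> U [set n | near0 eps (t n - l)]) -> l *+ k = 0.
Proof.
move=> tk lim; apply: contrapT => /near0_separated[eps e0]; apply.
have [d d0 dP] := near0_scale k e0.
have [n /= tn] : [set n | near0 d (t n - l)] !=set0.
  exact: (@filter_ex _ _ (@ultra_proper _ _ ultraU) _ (lim _ d0)).
by have /near0N := dP _ tn; rewrite mulrnBl tk sub0r opprK.
Qed.

End UltraLimit.

(** * The topology induced by a family of characters *)

Section CharacterTopology.
Variables (G : zmodType) (X : Type) (chi : X -> {additive G -> circle}).

Definition nbhd0 (F : seq X) (eps : R) (h : G) : Prop :=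
  forall x, List.In x F -> near0 eps (chi x h).

Definition chi_open (U : set G) : Prop := forall g, U g ->
  exists F eps, Rlt 0 eps /\ forall h, nbhd0 F eps (h - g) -> U h.

Lemma nbhd0_le F eps eps' h : Rle eps eps' -> nbhd0 F eps h -> nbhd0 F eps' h.
Proof. by move=> ee hF x /hF; exact: near0_le. Qed.

Lemma nbhd0_self F eps g : Rlt 0 eps -> nbhd0 F eps (g - g).
Proof. by move=> e0 x _; rewrite subrr raddf0; exact: near0_0. Qed.

Lemma near0_interior eps t : near0 eps t ->
  exists2 d, Rlt 0 d & forall u, near0 d u -> near0 eps (u + t).
Proof.
move=> [r rt re]; exists (Rminus eps (Rabs r)); first by lra.
move=> u [s <- sd]; exists (Rplus s r); first by rewrite toTD rt.
by have := Rabs_triang s r; lra.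
Qed.

Lemma nbhd0_interior F eps h : nbhd0 F eps h ->
  exists2 d, Rlt 0 d & forall k, nbhd0 F d k -> nbhd0 F eps (k + h).
Proof.
elim: F => [|x F IH] hF; first by exists R1; [lra | move=> k _ x].
have [|d d0 dP] := IH; first by move=> y yF; apply: hF; right.
have [|d' d'0 d'P] := @near0_interior eps (chi x h); first by apply: hF; left.
exists (Rmin d d'); first by apply: Rmin_glb_lt.
move=> k kF y [<-|yF]; first rewrite raddfD; last first.
  apply: dP => // z zF; apply: (@near0_le (Rmin d d')); first exact: Rmin_l.
  by apply: kF; right.
by apply: d'P; apply: near0_le (kF x _); [exact: Rmin_r | left].
Qed.

Lemma nbhd0_open F eps g : chi_open [set h | nbhd0 F eps (h - g)].
Proof.
move=> h /nbhd0_interior[d d0 dP]; exists F, d; split=> // k /dP.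
by rewrite addrA subrK.
Qed.

Lemma nbhd0_cat F F' eps h : nbhd0 (F ++ F') eps h -> nbhd0 F eps h /\ nbhd0 F' eps h.
Proof.
have inL x (A B : seq X) : List.In x A -> List.In x (A ++ B).
  by elim: A => //= a A IH [->|/IH]; [left | right].
have inR x (A B : seq X) : List.In x B -> List.In x (A ++ B).
  by elim: A => //= a A IH /IH; right.
by move=> hF; split=> x xF; apply: hF; [exact: inL | exact: inR].
Qed.

Lemma nbhd0B_half F eps h k :
  nbhd0 F (Rdiv eps 2) h -> nbhd0 F (Rdiv eps 2) k -> nbhd0 F eps (h - k).
Proof. by move=> hF kF x xF; rewrite raddfB; apply: near0B_half; [exact: hF | exact: kF]. Qed.

Lemma chi_group_topology :
  (forall g, g <> 0 -> exists x, chi x g <> 0) -> group_topology chi_open.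
Proof.
move=> sep; split.
- by split=> // g _; exists [::], R1; split=> //; lra.
- move=> C CO g [U CU Ug]; have [F [eps [e0 UF]]] := CO _ CU _ Ug.
  by exists F, eps; split=> // h /UF Uh; exists U.
- move=> U V UO VO g [Ug Vg].
  have [F [eps [e0 UF]]] := UO _ Ug; have [F' [eps' [e0' VF]]] := VO _ Vg.
  exists (F ++ F'), (Rmin eps eps'); split; first exact: Rmin_glb_lt.
  move=> h /nbhd0_cat[hF hF']; split.
    by apply: UF; apply: nbhd0_le hF; exact: Rmin_l.
  by apply: VF; apply: nbhd0_le hF'; exact: Rmin_r.
- move=> x y U UO Uxy; have [F [eps [e0 UF]]] := UO _ Uxy.
  exists [set h | nbhd0 F (Rdiv eps 2) (h - x)], [set h | nbhd0 F (Rdiv eps 2) (h - y)].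
  split; try exact: nbhd0_open; try by apply: nbhd0_self; lra.
  move=> a b aF bF; apply: UF; have := nbhd0B_half aF bF.
  by congr nbhd0; rewrite !opprB addrACA [RHS]addrACA [- x + _]addrC.
- move=> x y xy.
  have [|z zxy] := sep (x - y); first by move/eqP; rewrite subr_eq0 => /eqP.
  have [eps e0 neps] := near0_separated zxy.
  exists [set h | nbhd0 [:: z] (Rdiv eps 2) (h - x)],
    [set h | nbhd0 [:: z] (Rdiv eps 2) (h - y)].
  split; try exact: nbhd0_open; try by apply: nbhd0_self; lra.
  rewrite -subset0 => h [/= hx hy]; apply: neps.
  have := nbhd0B_half hy hx; rewrite opprB addrCA addrAC subrr add0r.
  by apply; left.
Qed.

Lemma near0_sum (xs : seq X) eps : Rlt 0 eps -> exists2 d, Rlt 0 d &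
  forall h, nbhd0 xs d h -> near0 eps (\sum_(x <- xs) chi x h).
Proof.
elim: xs eps => [|x xs IH] eps e0.
  by exists R1 => [|h _]; [lra | rewrite big_nil; exact: near0_0].
have [|d d0 dP] := IH (Rdiv eps 2); first by lra.
exists (Rmin d (Rdiv eps 2)); first by apply: Rmin_glb_lt; lra.
move=> h hF; rewrite big_cons.
apply: (@near0_le (Rplus (Rdiv eps 2) (Rdiv eps 2))); first by lra.
apply: near0D; first by apply: near0_le (hF x _); [exact: Rmin_r | left].
apply: dP => y yF; apply: near0_le (hF y _); [exact: Rmin_l | by right].
Qed.

Lemma chi_continuous_T (xs : seq X) :
  continuous_T chi_open (fun g => ofT (\sum_(x <- xs) chi x g)).
Proof.
move=> g eps e0; have [d d0 dP] := near0_sum xs e0.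
exists [set h | nbhd0 xs d (h - g)]; split; [exact: nbhd0_open | exact: nbhd0_self |].
move=> h /dP [r rE re]; set a := ofT _; set b := ofT _.
have /toT_eq0[z zE] : toT (Rminus (Rminus a b) r) = 0.
  rewrite !toTB rE !ofTK -sumrB -sumrB big1 // => x _.
  by rewrite raddfB subrr.
exists z; rewrite -zE (_ : Rminus _ _ = r) //; rewrite /Rminus; ring.
Qed.

(* If |f (g n)| >= n, an ultralimit of (g n) on the countably many coordinates
   controlling f near the points g n is attained at some g, and f is unbounded
   on every neighbourhood of g. *)
Lemma chi_pseudocompact (k : X -> nat) :
  (forall x g, chi x g *+ k x = 0) ->
  (forall (c : nat -> option X) (t : X -> circle), (forall x, t x *+ k x = 0) ->
     exists g, forall n x, c n = Some x -> chi x g = t x) ->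
  pseudocompact chi_open.
Proof.
move=> kchi rows f fcont; apply: contrapT => unb.
have /choice[gs gsP] : forall n, exists g, Rlt (INR n) (Rabs (f g)).
  move=> n; apply: contrapT => ng; apply: unb; exists (INR n) => x.
  by apply: Rnot_lt_le => nx; apply: ng; exists x.
have loc g : exists p : seq X * R, Rlt 0 p.2 /\
    forall h, nbhd0 p.1 p.2 (h - g) -> Rlt (Rabs (Rminus (f h) (f g))) 1.
  have [|U [UO Ug UP]] := fcont g R1; first by lra.
  have [F [eps [e0 FP]]] := UO _ Ug.
  by exists (F, eps); split=> // h /FP /UP.
have /choice[p pP] := loc.
have [U [ultraU evU]] := ultraFilterLemma eventually_filter.
have filterU : Filter U := @filter_filter _ _ (@ultra_proper _ _ ultraU).
have /choice[l lP] : forall x, exists l, forall eps, Rlt 0 eps ->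
    U [set n | near0 eps (chi x (gs n) - l)] by move=> x; exact: ultra_limit.
have lk x : l x *+ k x = 0.
  by apply: (ultra_limit_torsion ultraU) (lP x) => n.
(* The coordinates controlling [f] near the points [gs m] form one countable list, indexed by a
   point and a position, on which [g] attains the limit [l]. *)
have [g gP] := rows (fun m => List.nth_error (p (gs (unpair m).1)).1 (unpair m).2) l lk.
have gl n x : List.In x (p (gs n)).1 -> chi x g = l x.
  move=> xF; have [m nm] := List.In_nth_error _ _ xF; apply: (gP (pickle (n, m))).
  by rewrite unpairK.
have [e0 gloc] := pP g.
(* Two steps of size less than 1 will lead from [f g] to [f (gs n)] through a common point [h], so
   absolute values beyond $|f(g)|+2$ are absurd. *)
have [N NP] : exists N : nat, Rlt (Rplus (Rabs (f g)) 2) (INR N).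
  have [N NP] := INR_archimed 1 (Rplus (Rabs (f g)) 2) (ltac:(lra)).
  by exists N; lra.
have Ucl : U [set n | forall x, List.In x (p g).1 ->
    near0 (p g).2 (chi x (gs n) - l x)].
  elim: (p g).1 => [|x F IH]; first by apply: filterS filterT => n _ x.
  apply: filterS (filterI IH (lP x _ e0)) => n [/= nF nx] y [<-//|]; exact: nF.
have UN : U [set n | (N <= n)%N] by apply: evU; exists N.
have [n [/= nl Nn]] : ([set n | forall x, List.In x (p g).1 ->
    near0 (p g).2 (chi x (gs n) - l x)] `&` [set n | (N <= n)%N]) !=set0.
  exact: (@filter_ex _ _ (@ultra_proper _ _ ultraU) _ (filterI Ucl UN)).
(* [h] will copy [gs n] on the coordinates controlling [f] near [gs n], and [g] on the remaining
   ones of the two lists. Where the lists overlap it is still close to [g], as [gs n] is close to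
   the limit there. *)
pose t x := if `[< List.In x (p (gs n)).1 >] then chi x (gs n) else chi x g.
have [|h hP] := rows (fun m => List.nth_error ((p g).1 ++ (p (gs n)).1) m) t.
  by move=> x; rewrite /t; case: ifP.
have ht x : List.In x ((p g).1 ++ (p (gs n)).1) -> chi x h = t x.
  by move=> xF; have [m] := List.In_nth_error _ _ xF; exact: hP.
have [en nloc] := pP (gs n).
have := gsP n.
have /nloc : nbhd0 (p (gs n)).1 (p (gs n)).2 (h - gs n).
  move=> x xF; rewrite raddfB ht; last by apply/List.in_app_iff; right.
  by rewrite /t asboolT // subrr; exact: near0_0.
have /gloc : nbhd0 (p g).1 (p g).2 (h - g).
  move=> x xF; rewrite raddfB ht; last by apply/List.in_app_iff; left.
  rewrite /t; case: asboolP => [xn|_]; last by rewrite subrr; exact: near0_0.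
  by rewrite (gl n) //; exact: nl.
have Nn' : Rle (INR N) (INR n) by apply: le_INR; apply/ssrnat.leP.
have := Rabs_triang_inv (f h) (f g).
have := Rabs_triang_inv (f (gs n)) (f h); rewrite (Rabs_minus_sym (f (gs n))).
by lra.
Qed.

(** A homomorphism on a countable subgroup extends to [G] because the circle is divisible; a finite
    sum of characters agrees with the extension on the subgroup, and such sums are continuous. *)
Lemma chi_property_h :
  (forall (nu : nat -> G) (f : {additive G -> circle}), is_subgroup (range nu) ->
     exists xs : seq X, forall n, \sum_(x <- xs) chi x (nu n) = f (nu n)) ->
  property_h chi_open.
Proof.
move=> cols N subN cN f fhom.
pose F : set (G * circle) := [set z | N z.1 /\ z.2 = toT (f z.1)].
have fD x y : N x -> N y -> toT (f (x + y)) = toT (f x) + toT (f y).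
  move=> Nx Ny; have /toT_eq0 := fhom x y Nx Ny; rewrite !toTB => /eqP.
  by rewrite -addrA -opprD subr_eq0 => /eqP.
have N0 : N 0 by case: subN.
have f0 : toT (f 0) = 0.
  by have := fD 0 0 N0 N0; rewrite addr0 -[LHS]addr0 => /addrI.
have fB x y : N x -> N y -> toT (f (x - y)) = toT (f x) - toT (f y).
  move=> Nx Ny; have := fD (x - y) y (subgroupB subN Nx Ny) Ny.
  by rewrite subrK => ->; rewrite addrK.
have subF : is_subgroup F.
  split; first by split.
  move=> [a b] [c d] [/= Na ->] [/= Nc ->].
  by split=> /=; [exact: subgroupB | rewrite fB].
have funF : functional F by move=> m [_ /= ->].
have [h hP] := graph_extension divisible_circle subF funF.
have /countable_injP[j jI] := cN.
have /choice[nu nuP] : forall n, exists x, N x /\ forall y, N y -> j y = n -> y = x.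
  move=> n; have [[x [Nx xn]]|nx] := pselect (exists x, N x /\ j x = n).
    by exists x; split=> // y Ny yn; apply: jI; rewrite ?inE // xn.
  by exists 0; split=> // y Ny yn; case: nx; exists y.
have nuN : range nu = N.
  apply/seteqP; split=> [_ [n _ <-]|x Nx]; first by have [] := nuP n.
  by exists (j x) => //; have [_ /(_ x Nx erefl)] := nuP (j x).
have [|xs xsP] := cols nu h; first by rewrite nuN.
exists (fun g => ofT (\sum_(x <- xs) chi x g)); split; [|exact: chi_continuous_T|].
  move=> x y _ _; apply/toT_eq0; rewrite !toTB !ofTK -!sumrB big1 // => z _.
  by rewrite raddfD [chi z x + _]addrC addrK subrr.
move=> x Nx; apply/toT_eq0; rewrite toTB ofTK.
have [n _ <-] : range nu x by rewrite nuN.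
rewrite xsP (hP (nu n) (toT (f (nu n)))) ?subrr //; split=> //=.
by have [] := nuP n.
Qed.

End CharacterTopology.

(** * Assembling the topology from the summands *)

Lemma nice_topology (G : zmodType) (p : {additive G -> G}) :
  (forall g, p g = g) -> nice circle p ->
  exists tau : set (set G), [/\ group_topology tau, pseudocompact tau & property_h tau].
Proof.
move=> pid [X [k [chi [kchi _ rows cols]]]]; exists (chi_open chi).
have cols' (nu : nat -> G) (f : {additive G -> circle}) : is_subgroup (range nu) ->
    exists xs : seq X, forall n, \sum_(x <- xs) chi x (nu n) = f (nu n).
  by move=> subnu; apply: cols.
split; last exact: chi_property_h.
  apply: chi_group_topology => g g0.
  (* Points are told apart by the tests [x == y]. A character nonzero at [g] agrees on the cyclic
     group of [g] with a finite sum of members of [chi], one of which is then nonzero at [g]. *)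
  have [|phi phiP] := @separating_characters _ divisible_circle has_roots_circle G setT G 0
    (fun x y => x == y).
    move=> x y _ _ xy; have := congr1 (fun u => u y) xy.
    by rewrite eqxx => /eqP.
  have [l lg] := phiP g Logic.I g0.
  pose nu n := g *~ (odflt 0 (unpickle n)).
  have nuE k' : nu (pickle (k' : int)) = g *~ k' by rewrite /nu pickleK.
  have [|xs xsP] := cols' nu (phi l).
    split; first by exists (pickle (0 : int)) => //; rewrite nuE.
    move=> _ _ [m _ <-] [n _ <-].
    by exists (pickle (odflt 0 (unpickle m) - odflt 0 (unpickle n) : int)) => //;
       rewrite nuE mulrzBr.
  apply: contrapT => nx; apply: lg; have := xsP (pickle (1 : int)).
  rewrite nuE => <-; rewrite big1 // => x _.
  by apply: contrapT => xg; apply: nx; exists x.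
apply: (chi_pseudocompact kchi) => c t tk.
by have [g _ gP] := rows c t tk; exists g.
Qed.

(** Prescribing two coordinates is an open condition on the cube. A $G_\delta$-dense set of size at
    most $2^\kappa$ thus supplies the labels that separate the points of $G_0$. *)
Lemma Gdelta_dense_separates (X : Type) (D : set (X -> bool)) (x y : X) :
  Gdelta_dense D -> x <> y -> exists2 d, D d & d x <> d y.
Proof.
move=> denseD xy; pose S := [set d : X -> bool | d x /\ ~~ d y].
have [| |d [Dd [dx /negP dy]]] := denseD S.
- exists (fun=> S); split; last by rewrite bigcap_const //; exists 0%N.
  move=> _ f [fx fy]; exists [:: x; y] => g gf.
  by split; rewrite gf //=; [left | right; left].
- by exists (fun z => `[< z = x >]); split; [apply/asboolP | apply/asboolP => /esym].
by exists d => // dxy; apply: dy; rewrite -dxy.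
Qed.

(** The free family is the image of [A] under [p]: the kernel of [p] is torsion, so projecting
    preserves independence. The labels come from the dense set [D]. *)
Lemma nice_main_summand (G : zmodType) (P0 : seq nat) (I : eqType) (ord : I -> nat)
    (e : I -> G) (H A : set G) (P : nat -> Prop) (K : Type) (p : {additive G -> G}) :
  decomposition P0 ord e H -> max_independent A ->
  is_projection e H (fun i => `[< P (ord i) >]) true p ->
  star_with A K -> m_le {x : G | partial_sum ord e H P x} [set: K -> bool] ->
  nice circle p.
Proof.
move=> dec maxA pP starA [D [denseD DK]].
have [absQ QA _] := star_with_absorbing starA.
have psP := partial_sum_projection dec pP.
have pp := projection_idem dec pP.
have [d0 [Dd0 _]] : (D `&` setT) !=set0.
  apply: denseD; last by exists (fun=> true).
  exists (fun=> setT); split; last by rewrite bigcap_const //; exists 0%N.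
  by move=> _ f _; exists [::].
pose delta (g : G) (d : {d | D d}) : bool :=
  match pselect (partial_sum ord e H P g) with
  | left h => sval d (exist _ g h) | right _ => false end.
have deltaE g d h : delta g d = sval d (exist _ g h).
  by rewrite /delta; case: pselect => // h'; rewrite (Prop_irrelevance h h').
apply: (@nice_of_free_family circle divisible_circle has_roots_circle G p
  {x | x \in A} (p \o val) (nat -> K) {d | D d} (exist _ d0 Dd0) delta) => //.
- by move=> j; exact: pp.
- move=> s us s0 x xs.
  have [n n0] := projection_cotorsion dec (comb val s) pP.
  rewrite comb_additive s0 subr0 => sn.
  have [indA _] := maxA.
  have := indA [seq (val y.1, y.2 *+ n) | y <- s].
  rewrite -map_comp (map_comp val fst) (map_inj_uniq val_inj) => /(_ us).
  move=> /(_ _ _ (val x.1, x.2 *+ n)) xn.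
  apply/eqP; have /eqP : x.2 *+ n = 0.
    apply: xn; last by apply: (map_f (fun y => (val y.1, y.2 *+ n))).
      by move=> _ /mapP[y _ ->] /=; apply: set_mem; exact: valP.
    rewrite big_map -[RHS]sn -comb_scale /comb big_map.
    by apply: eq_bigr.
  by rewrite mulrn_eq0 -[n == 0%N]negbK -lt0n n0.
- move=> g pg; have [k [s [k0 gk]]] := max_independent_span maxA g.
  by exists k, s; split=> //; rewrite -comb_additive -gk raddfMn pg.
- apply: emb_trans QA _; exists (fun x => exist _ (sval x) (mem_set (svalP x))).
  by move=> [x hx] [y hy] /(congr1 sval) /= xy; exact: eq_exist.
- exact: emb_trans emb_circle (absorbing_sequences absQ (absorbing_bool absQ)).
- apply: emb_trans (emb_card_le DK) _; apply: emb_trans (@emb_setT _) _.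
  apply: emb_pow; exists (fun x _ => x) => x y h.
  exact: (congr1 (fun u => u 0%N) h).
- move=> x y /psP hx /psP hy dxy; apply: contrapT => xy.
  have [|d Dd] := @Gdelta_dense_separates _ D (exist _ x hx) (exist _ y hy) denseD.
    by move=> /(congr1 sval).
  have := congr1 (fun u => u (exist _ d Dd)) dxy.
  by rewrite (deltaE _ _ hx) (deltaE _ _ hy).
Qed.

Theorem theorem5p5 (G : zmodType) (P0 : seq nat) (I : eqType) (ord : I -> nat)
    (e : I -> G) (H : set G) (A : set G) :
  admits_pseudocompact G ->
  decomposition P0 ord e H ->
  (forall n : nat, (0 < n)%nat -> ([set h *+ n | h in H] #= H)%card) ->
  max_independent A ->
  let gamma := fun q : nat => [set i : I | ord i = q] in
  let P1 := fun q : nat => q \in P0 /\ ~ (gamma q #<= A)%card in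
  let G0 := partial_sum ord e H (fun q => ~ P1 q) in
  (forall q, P1 q -> star (gamma q)) ->
  (exists K : Type, star_with A K /\ m_le {x : G | G0 x} [set: K -> bool]) ->
  exists tau : set (set G), [/\ group_topology tau, pseudocompact tau & property_h tau].
Proof.
move=> _ dec _ maxA gamma P1 G0 starG [K [starA mG0]].
(* Starting from the projection onto [G0], the dominant summands are added one at a time along a
   list without repetition. *)
have nice_partial (l : seq nat) p : uniq l -> (forall q, q \in l -> P1 q) ->
    is_projection e H (fun i => `[< ~ P1 (ord i) >] || (ord i \in l)) true p ->
    nice circle p.
  elim: l p => [|q l IH] p /=.
    move=> _ _ pP; apply: (@nice_main_summand _ _ _ _ _ _ _ _ _ _ dec maxA _ starA mG0).
    by case: pP => pe pH; split=> // i; rewrite pe orbF.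
  move=> /andP[ql ul] lP pP.
  have P1q : P1 q by apply: lP; rewrite inE eqxx.
  have [p1 p1P] := projection_exists dec
    (fun i => `[< ~ P1 (ord i) >] || (ord i \in l)) true.
  have [p2 p2P] := projection_exists dec (fun i => ord i == q) false.
  have disj i : (`[< ~ P1 (ord i) >] || (ord i \in l)) && (ord i == q) = false.
    apply/negP => /andP[h /eqP iq]; move: h; rewrite iq (negPf ql) orbF => /asboolP.
    exact.
  have disj' i : (ord i == q) && (`[< ~ P1 (ord i) >] || (ord i \in l)) = false.
    by rewrite andbC.
  apply: (nice_add (projection_idem dec p1P) (projection_idem dec p2P)).
  - exact: (projection_orthogonal dec p1P p2P disj).
  - exact: (projection_orthogonal dec p2P p1P disj').
  - apply: (projection_add dec p1P p2P pP disj) => // i.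
    by rewrite inE [(_ == q) || _]orbC orbA.
  - apply: IH p1P => // r rl; apply: lP; by rewrite inE rl orbT.
  - exact: (nice_cyclic_summand dec emb_circle (starG _ P1q) p2P).
have [p pP] := projection_exists dec
  (fun i => `[< ~ P1 (ord i) >] || (ord i \in [seq q <- undup P0 | `[< P1 q >]])) true.
apply: (@nice_topology G p); last first.
  apply: nice_partial pP; first exact/filter_uniq/undup_uniq.
  by move=> q; rewrite mem_filter => /andP[/asboolP].
(* Every order is either non-dominant or on the list, so the final projection is the identity. *)
apply: (@decomposition_eq _ _ _ _ _ _ dec G p idfun) => [i|h Hh] /=; case: pP => pe pH.
  rewrite pe mem_filter mem_undup; case: asboolP => //= /contrapT P1i.
  by case: (P1i) => -> _; rewrite asboolT.
by rewrite pH.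
Qed.
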